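(* Let $\mathcal{X}_1,\mathcal{X}_2$ be finite sets, $\mathcal{H}^B$ a finite-dimensional Hilbert space, and $\{\rho^B_{x_1,x_2}\}_{x_1\in\mathcal{X}_1,x_2\in\mathcal{X}_2}$ a family of density operators on $\mathcal{H}^B$ (a classical-quantum multiple access channel with two senders and one receiver). Let $p_{X_1}$, $p_{X_2}$ be probability distributions on $\mathcal{X}_1$, $\mathcal{X}_2$, let $\delta>0$, and let $\mathcal{M}_i=\{1,\dots,2^{n(R_i-\delta)}\}$ for $i\in\{1,2\}$. Generate random codebooks $\{X_1^n(m_1)\}_{m_1\in\mathcal{M}_1}$ and $\{X_2^n(m_2)\}_{m_2\in\mathcal{M}_2}$, where every codeword is drawn independently from the product distribution $p_{X_i}^{\otimes n}$ on $\mathcal{X}_i^n$, and let $\rho_{x_1^n,x_2^n}=\rho_{x_{11},x_{21}}\otimes\cdots\otimes\rho_{x_{1n},x_{2n}}$. Suppose $$R_1\le I(X_1;B|X_2)_\theta,\qquad R_2\le I(X_2;B|X_1)_\theta,\qquad R_1+R_2\le I(X_1X_2;B)_\theta .$$ Then for all $\epsilon,\delta>0$ and all sufficiently large $n$ there exists a (codebook-dependent) POVM $\{\Lambda_{m_1,m_2}\}_{m_1\in\mathcal{M}_1,m_2\in\mathcal{M}_2}$ on $(\mathcal{H}^B)^{\otimes n}$ (a simultaneous decoder) such that the expected average probability of error satisfies $$\mathbb{E}_{X_1^n,X_2^n}\Big[\frac{1}{|\mathcal{M}_1||\mathcal{M}_2|}\sum_{m_1,m_2}\mathrm{Tr}\big\{(I-\Lambda_{m_1,m_2})\rho_{X_1^n(m_1),X_2^n(m_2)}\big\}\Big]\le\epsilon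 .$$
   Context: The information quantities are evaluated on the classical-quantum state $\theta^{X_1X_2B}=\sum_{x_1,x_2}p_{X_1}(x_1)p_{X_2}(x_2)|x_1\rangle\langle x_1|^{X_1}\otimes|x_2\rangle\langle x_2|^{X_2}\otimes\rho^B_{x_1,x_2}$, with $H(\cdot)$ the von Neumann entropy, $I(X_1;B|X_2)=H(B|X_2)-H(B|X_1X_2)$, etc. Logarithms are base 2. *)

(* Defs.v *)
(* mathcomp 2.5 + mathcomp-analysis (ln, powR) + real-closed (complex numbers R[i]). *)
From HB Require Import structures.
From mathcomp Require Import all_boot all_order all_algebra.
From mathcomp Require Import classical_sets reals exp.
From mathcomp Require Import complex.

Set Implicit Arguments.
Unset Strict Implicit.
Unset Printing Implicit Defensive.

Import Order.TTheory GRing.Theory Num.Theory.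
Local Open Scope ring_scope.

Section QInfo.
Variable R : realType.
Local Notation C := R[i].

(* A linear operator on the finite-dimensional Hilbert space C^T,          *)
(* given by its matrix entries w.r.t. the computational basis indexed by T. *)
Definition op (T : finType) := T -> T -> C.

Definition opmx (T : finType) (A : op T) : 'M[C]_#|T| :=
  \matrix_(i, j) A (enum_val i) (enum_val j).

Definition idop (T : finType) : op T := fun s t => (s == t)%:R.
Definition opsub (T : finType) (A B : op T) : op T := fun s t => A s t - B s t.
Definition opmul (T : finType) (A B : op T) : op T :=
  fun s t => \sum_(u : T) A s u * B u t.
Definition trace (T : finType) (A : op T) : C := \sum_(t : T) A t t.

(* positive semidefinite operators *)
Definition psd (T : finType) (A : op T) : Prop :=
  (forall s t, A s t = (A t s)^*) /\
  (forall v : T -> C, 0 <= \sum_(s : T) \sum_(t : T) (v s)^* * A s t * v t).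

(* density operators *)
Definition density (T : finType) (A : op T) : Prop := psd A /\ trace A = 1.

(* POVMs indexed by a finite set I *)
Definition povm (I T : finType) (L : I -> op T) : Prop :=
  (forall i, psd (L i)) /\ (forall s t, \sum_(i : I) L i s t = idop s t).

(* probability distributions on a finite set *)
Definition isdist (X : finType) (p : X -> R) : Prop :=
  (forall x, 0 <= p x) /\ \sum_(x : X) p x = 1.

(* eigenvalues (with multiplicity): the roots of the (monic) characteristic polynomial *)
Definition eigs (n : nat) (M : 'M[C]_n) : seq C :=
  sval (closed_field_poly_normal (char_poly M)).

Definition log2 (x : R) : R := ln x / ln 2.

(* von Neumann entropy  H(A) = - sum_lambda lambda log2 lambda  (0 log 0 = 0) *)
Definition vnH (T : finType) (A : op T) : R :=
  - \sum_(l <- eigs (opmx A)) (complex.Re l * log2 (complex.Re l)).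

(* partial traces and reindexing *)
Definition ptrL (A B : finType) (M : op (A * B)%type) : op B :=
  fun b b' => \sum_(a : A) M (a, b) (a, b').
Definition ptrR (A B : finType) (M : op (A * B)%type) : op A :=
  fun a a' => \sum_(b : B) M (a, b) (a', b).
Definition reidx (S T : finType) (g : S -> T) (M : op T) : op S :=
  fun s s' => M (g s) (g s').

Section CQ.
Variables (X1 X2 : finType) (d : nat).
Variables (p1 : X1 -> R) (p2 : X2 -> R) (rho : X1 -> X2 -> op 'I_d).

(* theta^{X1 X2 B} = sum p1(x1) p2(x2) |x1><x1| (x) |x2><x2| (x) rho_{x1,x2} *)
Definition theta : op ((X1 * X2) * 'I_d)%type :=
  fun s t => (s.1 == t.1)%:R * ((p1 s.1.1 * p2 s.1.2)%:C)%C * rho s.1.1 s.1.2 s.2 t.2.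

Definition theta_X1X2 : op (X1 * X2)%type := ptrR theta.
Definition theta_B : op 'I_d := ptrL theta.
Definition theta_X2B : op (X2 * 'I_d)%type :=
  ptrL (reidx (fun u : (X1 * (X2 * 'I_d))%type => ((u.1, u.2.1), u.2.2)) theta).
Definition theta_X1B : op (X1 * 'I_d)%type :=
  ptrL (reidx (fun u : (X2 * (X1 * 'I_d))%type => ((u.2.1, u.1), u.2.2)) theta).
Definition theta_X1 : op X1 := ptrR theta_X1X2.
Definition theta_X2 : op X2 := ptrL theta_X1X2.

(* conditional entropies H(B|Y) = H(Y B) - H(Y) *)
Definition H_B_X1X2 : R := vnH theta - vnH theta_X1X2.
Definition H_B_X2 : R := vnH theta_X2B - vnH theta_X2.
Definition H_B_X1 : R := vnH theta_X1B - vnH theta_X1.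
Definition H_B : R := vnH theta_B.

(* I(X1;B|X2), I(X2;B|X1), I(X1 X2;B) *)
Definition I_X1_B_X2 : R := H_B_X2 - H_B_X1X2.
Definition I_X2_B_X1 : R := H_B_X1 - H_B_X1X2.
Definition I_X1X2_B : R := H_B - H_B_X1X2.

(* rho_{x1^n, x2^n} = rho_{x11,x21} (x) ... (x) rho_{x1n,x2n} on (C^d)^{(x) n} *)
Definition rho_n (n : nat) (x1 : n.-tuple X1) (x2 : n.-tuple X2) : op (n.-tuple 'I_d) :=
  fun b b' => \prod_(k < n) rho (tnth x1 k) (tnth x2 k) (tnth b k) (tnth b' k).

End CQ.

(* |M| = 2^{n(R - delta)}, rounded up to an integer *)
Definition msize (n : nat) (r delta : R) : nat :=
  `|Num.ceil (2 `^ (n%:R * (r - delta)))|%N.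

(* probability of a random codebook whose codewords are i.i.d. ~ p^{(x) n} *)
Definition cbprob (X : finType) (p : X -> R) (M n : nat)
  (c : {ffun 'I_M -> n.-tuple X}) : R :=
  \prod_(m < M) \prod_(k < n) p (tnth (c m) k).

(* E_{X1^n,X2^n} [ 1/(|M1||M2|) sum_{m1,m2} Tr{(I - Lambda_{m1,m2}) rho_{X1^n(m1),X2^n(m2)}} ] *)
Definition exp_avg_err (X1 X2 : finType) (d : nat) (p1 : X1 -> R) (p2 : X2 -> R)
  (rho : X1 -> X2 -> op 'I_d) (n M1 M2 : nat)
  (L : {ffun 'I_M1 -> n.-tuple X1} -> {ffun 'I_M2 -> n.-tuple X2} ->
       'I_M1 -> 'I_M2 -> op (n.-tuple 'I_d)) : R :=
  \sum_(c1 : {ffun 'I_M1 -> n.-tuple X1}) \sum_(c2 : {ffun 'I_M2 -> n.-tuple X2})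
    cbprob p1 c1 * cbprob p2 c2 *
    ((M1%:R * M2%:R)^-1 *
      \sum_(m1 < M1) \sum_(m2 < M2)
        complex.Re (trace (opmul (opsub (@idop _) (L c1 c2 m1 m2)) (rho_n rho (c1 m1) (c2 m2))))).

End QInfo.

(* Main.v *)
(* The receiver tests a pair of codewords with
     S(x1,x2) = P0 P(x1) P(x1,x2) P(x1) P0,
   where the P's are projectors onto eigenvalues of the averaged states
   rho^n, rho_x1, rho_x1x2 close to 2^(-n H), and turns the tests into a POVM by
   the square-root construction.  The Hayashi-Nagaoka inequality
     1 - L_m <= 2 (1 - S_m) + 4 sum_(j <> m) S_j + eps
   splits the error.  The term 1 - S_m is small by the operator union bound
     1 - S <= t + (4/t) sum_i (1 - P_i)
   and the weak law of large numbers, which applies to the logarithms of the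
   eigenvalues because they are i.i.d. when codewords and eigenvectors are drawn
   jointly.  For the cross terms rho_x1x2 is first pinched by P(x2).  The
   expectation over the codebook then contracts with one of
   P(x2) rho_x2 P(x2) <= 2^(-n H(B|X2)), P(x1) rho_x1 P(x1) <= 2^(-n H(B|X1)),
   P0 rho^n P0 <= 2^(-n H(B)), while P(x1,x2) <= 2^(n H(B|X1X2)) rho_x1x2 bounds
   the trace of the test; the three resulting exponents are the three rate
   constraints. *)
Require Import Defs.
From HB Require Import structures.
From mathcomp Require Import all_boot all_order all_algebra.
From mathcomp Require Import classical_sets reals exp.
From mathcomp Require Import complex.
From mathcomp Require Import spectral sesquilinear ring lra.

Set Implicit Arguments.
Unset Strict Implicit.
Unset Printing Implicit Defensive.

Import Order.TTheory GRing.Theory Num.Theory.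
Local Open Scope ring_scope.
Local Open Scope sesquilinear_scope.

(** * Real parts of complex numbers *)

Section ComplexRe.
Variable R : realType.
Local Notation C := R[i].
Local Notation Re := (@complex.Re R).

Lemma ReD (x y : C) : Re (x + y) = Re x + Re y.
Proof. by case: x; case: y. Qed.

Lemma ReN (x : C) : Re (- x) = - Re x.
Proof. by case: x. Qed.

Lemma ReZ (a : R) (x : C) : Re (a%:C%C * x) = a * Re x.
Proof. by case: x => u v /=; rewrite mul0r subr0. Qed.

Lemma Re_sum (I : Type) (r : seq I) (P : pred I) (F : I -> C) :
  Re (\sum_(i <- r | P i) F i) = \sum_(i <- r | P i) Re (F i).
Proof. by apply: (big_morph _ ReD). Qed.

Lemma Re_conj (x : C) : Re (x^*) = Re x.
Proof. by case: x. Qed.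

Lemma Re_sqn (x : C) : 0 <= Re (x^* * x).
Proof. by case: x => a b /=; nra. Qed.

Lemma conj_RC (a : R) : (a%:C%C : C)^* = a%:C%C.
Proof. by rewrite conj_Creal // ?complex_real. Qed.

End ComplexRe.

(** * Quadratic forms, traces and spectral calculus *)

Section Forms.
Variables (R : realType) (n : nat).
Local Notation C := R[i].
Local Notation Re := (@complex.Re R).
Local Notation M := 'M[C]_n.
Implicit Types (A B K : M) (v w : 'cV[C]_n).

Lemma adjM m p q (A : 'M[C]_(m, p)) (B : 'M[C]_(p, q)) :
  (A *m B)^t* = B^t* *m A^t*.
Proof. by rewrite trmx_mul map_mxM. Qed.

Lemma adjD m p (A B : 'M[C]_(m, p)) : (A + B)^t* = A^t* + B^t*.
Proof. by rewrite linearD /= map_mxD. Qed.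

Lemma adjB m p (A B : 'M[C]_(m, p)) : (A - B)^t* = A^t* - B^t*.
Proof. by rewrite linearB /= map_mxB. Qed.

Lemma adj_sum m p (I : finType) (P : pred I) (F : I -> 'M[C]_(m, p)) :
  (\sum_(i | P i) F i)^t* = \sum_(i | P i) (F i)^t*.
Proof.
apply: (big_morph (fun A : 'M[C]_(m, p) => A^t*)) => [A B|]; first exact: adjD.
by rewrite trmx0 map_mx0.
Qed.

Lemma adjZ m p (a : R) (A : 'M[C]_(m, p)) : (a%:C%C *: A)^t* = a%:C%C *: A^t*.
Proof. by apply/matrixP => i j; rewrite !mxE rmorphM /= conj_RC. Qed.

Lemma adj1 : (1%:M : M)^t* = 1%:M.
Proof. by rewrite trmx1 map_mx1. Qed.

(** Taking the real part keeps every comparison in [R]; for Hermitian [A] nothing is lost, since the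
    form is already real. *)
Definition qf A v : R := Re ((v^t* *m A *m v) 0 0).

Lemma qfD A B v : qf (A + B) v = qf A v + qf B v.
Proof. by rewrite /qf mulmxDr mulmxDl mxE ReD. Qed.

Lemma qfN A v : qf (- A) v = - qf A v.
Proof. by rewrite /qf mulmxN mulNmx mxE ReN. Qed.

Lemma qfB A B v : qf (A - B) v = qf A v - qf B v.
Proof. by rewrite qfD qfN. Qed.

Lemma qfZ a A v : qf (a%:C%C *: A) v = a * qf A v.
Proof. by rewrite /qf -scalemxAr -scalemxAl mxE ReZ. Qed.

Lemma qf0 v : qf 0 v = 0.
Proof. by rewrite /qf mulmx0 mul0mx mxE. Qed.

Lemma qf_sum (I : Type) (r : seq I) (P : pred I) (F : I -> M) v :
  qf (\sum_(i <- r | P i) F i) v = \sum_(i <- r | P i) qf (F i) v.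
Proof. by apply: (big_morph (fun A => qf A v)) => [A B|]; rewrite ?qfD ?qf0. Qed.

Lemma qf_conj K A v : qf (K^t* *m A *m K) v = qf A (K *m v).
Proof. by rewrite /qf adjM !mulmxA. Qed.

Lemma qf1_ge0 v : 0 <= qf 1%:M v.
Proof.
rewrite /qf mulmx1 mxE Re_sum; apply: sumr_ge0 => i _.
by rewrite !mxE Re_sqn.
Qed.

Lemma qf_gram_ge0 K v : 0 <= qf (K^t* *m K) v.
Proof. by rewrite -[K^t*]mulmx1 qf_conj qf1_ge0. Qed.

(** Parallelogram law: the cross terms cancel, whether or not [A] is Hermitian. *)
Lemma qf_polar A v w : qf A (v + w) + qf A (v - w) = 2 * qf A v + 2 * qf A w.
Proof.
have E (X Y Z U : 'M[C]_1) :
    Re ((X + Y + (Z + U)) 0 0) + Re ((X - Y - (Z - U)) 0 0) =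
    2 * Re (X 0 0) + 2 * Re (U 0 0).
  rewrite !mxE !(ReD, ReN).
  by move: (Re (X 0 0)) (Re (Y 0 0)) (Re (Z 0 0)) (Re (U 0 0)) => x y z u; ring.
rewrite /qf adjD adjB 2!mulmxDl 2!mulmxDr.
by rewrite 2!mulmxBl 2!mulmxBr E.
Qed.

(* On Hermitian matrices this is the Loewner order. *)
Definition leo A B := forall v, qf A v <= qf B v.

Lemma qf_add_le A v w : leo 0 A -> qf A (v + w) <= 2 * qf A v + 2 * qf A w.
Proof. by move=> A0; rewrite -qf_polar lerDl -(qf0 (v - w)); apply: A0. Qed.

Lemma leo_conj K A B : leo A B -> leo (K^t* *m A *m K) (K^t* *m B *m K).
Proof. by move=> AB v; rewrite !qf_conj. Qed.

Lemma leo_trans A B D : leo A B -> leo B D -> leo A D.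
Proof. by move=> h k v; apply: le_trans (h v) (k v). Qed.

(** Expectation of the observable [A] in the state [B]. *)
Definition ev A B : R := Re (\tr (A *m B)).

Lemma evDl A B D : ev (A + B) D = ev A D + ev B D.
Proof. by rewrite /ev mulmxDl mxtraceD ReD. Qed.
Lemma evZl a A D : ev (a%:C%C *: A) D = a * ev A D.
Proof. by rewrite /ev -scalemxAl linearZ ReZ. Qed.
Lemma ev0l D : ev 0 D = 0.
Proof. by rewrite /ev mul0mx mxtrace0. Qed.
Lemma ev_suml (I : Type) (r : seq I) (P : pred I) (F : I -> M) D :
  ev (\sum_(i <- r | P i) F i) D = \sum_(i <- r | P i) ev (F i) D.
Proof. by apply: (big_morph (fun A => ev A D)) => [A B|]; rewrite ?evDl ?ev0l. Qed.
Lemma evC A B : ev A B = ev B A.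
Proof. by rewrite /ev mxtrace_mulC. Qed.
Lemma evZr a A D : ev D (a%:C%C *: A) = a * ev D A.
Proof. by rewrite evC evZl (evC D). Qed.
Lemma ev_sumr (I : Type) (r : seq I) (P : pred I) (F : I -> M) D :
  ev D (\sum_(i <- r | P i) F i) = \sum_(i <- r | P i) ev D (F i).
Proof. by rewrite evC ev_suml; apply: eq_bigr => i _; rewrite evC. Qed.
Lemma ev_mulA A K L B : ev (A *m K *m L) B = ev K (L *m B *m A).
Proof. by rewrite /ev -!mulmxA mxtrace_mulC !mulmxA. Qed.

(** Positivity as a Gram factorization: traces against [A] become sums of quadratic forms, and
    conjugation only changes the factor. [pos_ge0] and [herm_pos] connect it with [leo]. *)
Definition pos A := exists K, A = K *m K^t*.

(** By cyclicity the trace of A K K^* is that of K^* A K, whose diagonal entries are forms at the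
    columns of [K]. *)
Lemma ev_col A K : ev A (K *m K^t*) = \sum_j qf A (col j K).
Proof.
rewrite /ev mulmxA mxtrace_mulC mulmxA /mxtrace Re_sum; apply: eq_bigr => j _.
rewrite /qf; congr Re; rewrite !mxE; apply: eq_bigr => k _; rewrite !mxE.
by congr (_ * _); apply: eq_bigr => l _; rewrite !mxE.
Qed.

Lemma ev_mono A B D : leo A B -> pos D -> ev A D <= ev B D.
Proof. by move=> AB [K ->]; rewrite !ev_col; apply: ler_sum. Qed.

Lemma pos_ge0 A : pos A -> leo 0 A.
Proof. by move=> [K ->] v; rewrite qf0 -{1}[K](@trmxCK C) qf_gram_ge0. Qed.

Lemma pos_herm A : pos A -> A^t* = A.
Proof. by move=> [K ->]; rewrite adjM trmxCK. Qed.

Lemma pos_conj K A : pos A -> pos (K *m A *m K^t*).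
Proof. by move=> [L ->]; exists (K *m L); rewrite adjM !mulmxA. Qed.

End Forms.

(** * Functional calculus for Hermitian matrices *)

Section Spectral.
Variables (R : realType) (n : nat).
Local Notation C := R[i].
Local Notation M := 'M[C]_n.
Implicit Types (A B K W : M) (f g : 'I_n -> R).

(* For unitary W, the function f applied to the spectrum of W diag(i) W^*. *)
Definition fcm W f : M := W *m diag_mx (\row_i (f i)%:C%C) *m W^t*.

Lemma fcm_adj W f : (fcm W f)^t* = fcm W f.
Proof.
rewrite /fcm; set D := diag_mx _; have hD : D^t* = D.
  rewrite tr_diag_mx map_diag_mx; congr diag_mx; apply/rowP => i; rewrite !mxE.
  exact: conj_RC.
by rewrite [LHS]adjM (adjM W) (trmxCK W) hD mulmxA.
Qed.

Lemma fcmM W f g : W^t* *m W = 1%:M ->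
  fcm W f *m fcm W g = fcm W (fun i => f i * g i).
Proof.
move=> WW; rewrite /fcm !mulmxA -(mulmxA _ (W^t*)) WW mulmx1 -(mulmxA W).
rewrite mulmx_diag; congr (W *m diag_mx _ *m _).
by apply/rowP=> i; rewrite !mxE rmorphM.
Qed.

Lemma fcm_cst W a : W *m W^t* = 1%:M -> fcm W (fun=> a) = a%:C%C *: 1%:M.
Proof.
move=> WW; rewrite /fcm (_ : \row__ _ = const_mx a%:C%C); last first.
  by apply/rowP => i; rewrite !mxE.
by rewrite diag_const_mx mul_mx_scalar -scalemxAl WW.
Qed.

Lemma fcmD W f g : fcm W (fun i => f i + g i) = fcm W f + fcm W g.
Proof.
rewrite /fcm -mulmxDl -mulmxDr -linearD /=; congr (W *m diag_mx _ *m _).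
by apply/rowP => i; rewrite !mxE rmorphD.
Qed.

Lemma fcmN W f : fcm W (fun i => - f i) = - fcm W f.
Proof.
rewrite /fcm -mulNmx -mulmxN -linearN /=; congr (W *m diag_mx _ *m _).
by apply/rowP => i; rewrite !mxE rmorphN.
Qed.

Lemma fcmZ W f a : fcm W (fun i => a * f i) = a%:C%C *: fcm W f.
Proof.
rewrite /fcm scalemxAl scalemxAr -linearZ /=; congr (W *m diag_mx _ *m _).
by apply/rowP => i; rewrite !mxE rmorphM.
Qed.

Lemma fcm_pos W f : (forall i, 0 <= f i) -> pos (fcm W f).
Proof.
move=> f0; exists (W *m diag_mx (\row_i (Num.sqrt (f i))%:C%C)).
rewrite adjM tr_diag_mx map_diag_mx mulmxA -(mulmxA W) mulmx_diag.
congr (W *m diag_mx _ *m _); apply/rowP => i; rewrite !mxE.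
by rewrite [X in _ * X]conj_RC -rmorphM /= -expr2 sqr_sqrtr.
Qed.

Lemma fcm_le W f g : (forall i, f i <= g i) -> leo (fcm W f) (fcm W g).
Proof.
move=> fg v; rewrite -subr_ge0 -qfB -fcmN -fcmD -(qf0 v).
by apply/pos_ge0/fcm_pos => i; rewrite subr_ge0.
Qed.

Lemma fcm_trace W f : W^t* *m W = 1%:M -> \tr (fcm W f) = (\sum_i f i)%:C%C.
Proof.
move=> WW; rewrite /fcm mxtrace_mulC mulmxA WW mul1mx mxtrace_diag.
by rewrite rmorph_sum; apply: eq_bigr => i _; rewrite mxE.
Qed.

Lemma fcm_col W f j : W^t* *m W = 1%:M ->
  fcm W f *m col j W = (f j)%:C%C *: col j W.
Proof.
move=> WW; rewrite colE /fcm mulmxA -(mulmxA _ (W^t*)) WW mulmx1 -mulmxA scalemxAr.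
congr (_ *m _); apply/matrixP => i k; rewrite mul_diag_mx !mxE.
by case: eqP => [->|]; rewrite ?mulr0.
Qed.

Lemma qf_col W j : W^t* *m W = 1%:M -> qf 1%:M (col j W) = 1.
Proof.
move=> WW; rewrite /qf mulmx1; have := congr1 (fun B : M => complex.Re (B j j)) WW.
rewrite !mxE eqxx /= => <-; congr complex.Re; apply: eq_bigr => k _.
by rewrite !mxE.
Qed.

Lemma spectral_herm A : A^t* = A ->
  exists W f, [/\ A = fcm W f, W^t* *m W = 1%:M & W *m W^t* = 1%:M].
Proof.
move=> hA; have hsym : A \is hermsymmx.
  by apply/is_hermitianmxP; rewrite expr0 scale1r hA.
have /hermitian_normalmx/orthomx_spectralP := hsym.
set W := spectralmx A; set D := spectral_diag A => eA.
have uW : W \is unitarymx by apply: spectral_unitarymx.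
have WW : W *m W^t* = 1%:M by apply/unitarymxP.
(* The decomposition at hand reads A = W^-1 D W, so the eigenvectors are the columns of the adjoint
   of [W]. *)
exists (W^t*), (fun i => complex.Re (D 0 i)); split; rewrite ?trmxCK //.
- rewrite /fcm (trmxCK W) {1}eA (invmx_unitary uW).
  have <- : D = \row_i (complex.Re (D 0 i))%:C%C.
    apply/rowP => i; rewrite !mxE.
    have /mxOverP/(_ 0 i) := hermitian_spectral_diag_real hsym.
    by move=> /RRe_real ->.
  by [].
- exact: mulmx1C.
Qed.

Lemma opposite_signs_absurd (a b g : R) : g < 0 -> 0 <= a -> 0 <= b -> b + a <= 0 ->
  b - a = g -> False.
Proof. by lra. Qed.

(* Operator monotonicity of the square root: if w is an eigenvector of B - A
   with eigenvalue g < 0, then w^*(B^2 - A^2)w = g w^*(A + B)w forces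
   w^*Aw = w^*Bw = 0, hence g = 0. *)
Lemma leo_sqrt A B : A^t* = A -> B^t* = B -> leo 0 A -> leo 0 B ->
  leo (A *m A) (B *m B) -> leo A B.
Proof.
move=> hA hB pA pB AB.
have [|W [g [eg WW WW']]] := @spectral_herm (B - A); first by rewrite adjB hA hB.
suff g0 i : 0 <= g i.
  by move=> v; rewrite -subr_ge0 -qfB eg -(qf0 v); apply/pos_ge0/fcm_pos.
rewrite leNgt; apply/negP => gi0; set w := col i W.
have ew : (B - A) *m w = (g i)%:C%C *: w by rewrite eg fcm_col.
have ewt : w^t* *m (B - A) = (g i)%:C%C *: w^t*.
  by rewrite -adjZ -ew adjM adjB hA hB.
have e : B *m B - A *m A = B *m (B - A) + (B - A) *m A.
  by rewrite mulmxBr mulmxBl addrA subrK.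
have e1 : qf (B *m (B - A)) w = g i * qf B w.
  by rewrite /qf -!mulmxA ew -!scalemxAr mxE ReZ.
have e2 : qf ((B - A) *m A) w = g i * qf A w.
  by rewrite /qf !mulmxA ewt -!scalemxAl mxE ReZ.
have := AB w; rewrite -subr_ge0 -qfB e qfD e1 e2 -mulrDr.
have := pB w; have := pA w; rewrite !qf0 => a0 b0.
rewrite nmulr_rge0 // => ab.
have : qf (B - A) w = g i.
  rewrite /qf -mulmxA ew -scalemxAr mxE ReZ -[w^t*]mulmx1.
  by rewrite -/(qf 1%:M w) qf_col // mulr1.
rewrite qfB; exact: opposite_signs_absurd gi0 a0 b0 ab.
Qed.

End Spectral.

(** * The square-root measurement and projector inequalities *)

Section Measurement.
Variables (R : realType) (n : nat).
Local Notation C := R[i].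
Local Notation M := 'M[C]_n.
Implicit Types (A B P S X : M) (v w : 'cV[C]_n).

Lemma qf_fcm_col (W : M) (f : 'I_n -> R) i : W^t* *m W = 1%:M ->
  qf (fcm W f) (col i W) = f i.
Proof.
move=> WW; rewrite /qf -mulmxA fcm_col // -scalemxAr mxE ReZ.
by rewrite -[(col i W)^t*]mulmx1 -/(qf 1%:M (col i W)) qf_col // mulr1.
Qed.

Lemma herm_pos A : A^t* = A -> leo 0 A -> pos A.
Proof.
move=> hA A0; have [W [f [eA WW _]]] := spectral_herm hA.
rewrite eA; apply: fcm_pos => i.
by rewrite -(qf_fcm_col f i WW) -eA -(qf0 (col i W)).
Qed.

Lemma leo_sqr A : pos A -> leo A 1%:M -> leo (A *m A) A.
Proof.
move=> pA A1; have [W [f [eA WW _]]] := spectral_herm (pos_herm pA).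
rewrite eA (fcmM _ _ WW); apply: fcm_le => i; set a := f i.
have : 0 <= a by rewrite /a -(qf_fcm_col f i WW) -eA -(qf0 (col i W)); apply: pos_ge0.
have : a <= 1 by rewrite /a -(qf_fcm_col f i WW) -eA -(qf_col i WW).
by nra.
Qed.

(** The variables are values of forms: with Q = T - S' i, [q1], [qs], [qq], [qT], [qb] stand for 1,
    S i, Q, T, T^(1/2) at v, [qS] for the sum of the other S j, and [qav] for Q at T^(-1/2) v -
    v. *)
Lemma hayashi_nagaoka_arith (e k eps q1 qs qS qq qav qT qb : R) : 0 <= e -> 0 <= q1 -> qs <= q1 ->
  4 * e * k <= eps -> qT = (1 - e) * qs + e * q1 + qq ->
  (1 - e) * qs + e * q1 <= qb -> qav <= q1 - 2 * qb + qT ->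
  qq <= qS + e * k * q1 ->
  2 * qav + 2 * qq <= 2 * (q1 - qs) + 4 * qS + eps * q1.
Proof.
move=> e0 q10 sq ek hT hb hav hq.
have : 4 * e * k * q1 <= eps * q1 by rewrite ler_wpM2r.
have : 0 <= e * (q1 - qs) by rewrite mulr_ge0 ?subr_ge0.
by lra.
Qed.

(* Mixing S i with a little identity makes T = \sum_i S' i invertible; then
   L i = T^(-1/2) S' i T^(-1/2) is the square-root measurement. *)
Lemma hayashi_nagaoka (I : finType) (i0 : I) (S : I -> M) (eps : R) :
  0 < eps -> (forall i, pos (S i)) -> (forall i, leo (S i) 1%:M) ->
  exists L : I -> M, [/\ forall i, pos (L i), \sum_i L i = 1%:M &
    forall i v, qf (1%:M - L i) v <=
      2 * qf (1%:M - S i) v + 4 * (\sum_(j | j != i) qf (S j) v) + eps * qf 1%:M v].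
Proof.
move=> eps0 Spos S1; set k : R := #|I|%:R; have k0 : 0 <= k by apply: ler0n.
have [e [e0 e1 ek]] : exists e : R, [/\ 0 < e, e <= 1 & 4 * e * k <= eps].
  (* The summand [eps] in the denominator forces e <= 1, while e (4 k + eps) = eps gives 4 e k <=
     eps. *)
  exists (eps / (4 * k + eps)); set e := _ / _.
  have e0 : 0 < e by rewrite divr_gt0 //; lra.
  have e1 : e <= 1 by rewrite ler_pdivrMr; lra.
  have ee : e * (4 * k + eps) = eps by rewrite divfK // gt_eqF //; lra.
  by split=> //; nra.
pose S' i : M := (1 - e)%:C%C *: S i + e%:C%C *: 1%:M.
have qS' i v : qf (S' i) v = (1 - e) * qf (S i) v + e * qf 1%:M v.
  by rewrite qfD !qfZ.
have qS0 i v : 0 <= qf (S i) v by rewrite -(qf0 v); apply: pos_ge0.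
have q10 := @qf1_ge0 R n.
have S'pos i : pos (S' i).
  apply: herm_pos => [|v]; first by rewrite adjD !adjZ adj1 pos_herm.
  rewrite qf0 qS'; apply: addr_ge0.
    by apply: mulr_ge0 (qS0 i v); rewrite subr_ge0.
  exact: mulr_ge0 (ltW e0) (q10 v).
have S'1 i : leo (S' i) 1%:M.
  move=> v; rewrite qS' -lerBrDr -{1}(mul1r (qf 1%:M v)) -mulrBl.
  by apply: ler_wpM2l; [rewrite subr_ge0|apply: S1].
pose T : M := \sum_i S' i.
have hT : T^t* = T by rewrite adj_sum; apply: eq_bigr => i _; rewrite pos_herm.
have [W [f [eT WW WW']]] := spectral_herm hT.
have qS'0 i v : 0 <= qf (S' i) v by rewrite -(qf0 v); apply: pos_ge0.
(* The identity mixed into S' i0 alone already gives T >= e 1. *)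
have f0 i : 0 < f i.
  rewrite -(qf_fcm_col f i WW) -eT qf_sum (bigD1 i0) //=.
  apply: ltr_wpDr; first by apply: sumr_ge0.
  by rewrite qS' qf_col // mulr1 ltr_wpDl // mulr_ge0 // subr_ge0.
pose s i := Num.sqrt (f i); have s0 i : 0 < s i by rewrite sqrtr_gt0.
have ss i : s i * s i = f i by rewrite -expr2 sqr_sqrtr // ltW.
(* B = T^(1/2) and A = T^(-1/2). *)
pose B := fcm W s; pose A := fcm W (fun i => (s i)^-1).
have hA : A^t* = A by apply: fcm_adj.
have BB : B *m B = T by rewrite (fcmM _ _ WW) eT; congr fcm; apply/boolp.funext.
have ATA : A *m T *m A = 1%:M.
  rewrite eT !(fcmM _ _ WW) -(scale1r 1%:M) -(fcm_cst 1 WW'); congr fcm.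
  by apply/boolp.funext => i; rewrite -ss; field; rewrite gt_eqF.
have TS' i : leo (S' i) T.
  by move=> v; rewrite qf_sum (bigD1 i) //= lerDl sumr_ge0.
(* S'^2 <= S' <= T = B^2, and the square root is operator monotone. *)
have BS' i : leo (S' i) B.
  apply: leo_sqrt; [exact: pos_herm|exact: fcm_adj|exact: pos_ge0| |].
    by apply/pos_ge0/fcm_pos => j; apply: ltW.
  by rewrite BB; apply: leo_trans (TS' i); apply: leo_sqr.
exists (fun i => A *m S' i *m A); split=> [i||i v].
- by rewrite -{2}hA; apply: pos_conj.
- by rewrite -mulmx_suml -mulmx_sumr.
set Q := T - S' i.
have qQ w : qf Q w = \sum_(j | j != i) qf (S' j) w.
  by rewrite qfB qf_sum (bigD1 i) //= addrAC subrr add0r.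
have -> : 1%:M - A *m S' i *m A = A *m Q *m A.
  by rewrite -ATA mulmxBr mulmxBl.
have Q0 : leo 0 Q by move=> w; rewrite qf0 qQ sumr_ge0.
(* Splitting A v = (A v - v) + v bounds Q at A v by twice Q at A v - v plus twice Q at v. *)
rewrite -{1}hA qf_conj -[A *m v](subrK v).
apply: le_trans (qf_add_le _ _ Q0) _.
(* Q <= T, and (A - 1) T (A - 1) = 1 - 2 B + T because A, B and T are functions of the same
   matrix. *)
have QT : qf Q (A *m v - v) <= qf 1%:M v - 2 * qf B v + qf T v.
  have -> : qf 1%:M v - 2 * qf B v + qf T v = qf T (A *m v - v).
    rewrite (_ : A *m v - v = (A - 1%:M) *m v); last by rewrite mulmxBl mul1mx.
    rewrite -qf_conj -qfZ -qfB -qfD.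
    have e1m : 1%:M = fcm W (fun=> 1) by rewrite (fcm_cst _ WW') scale1r.
    have -> : A - 1%:M = fcm W (fun i => (s i)^-1 - 1) by rewrite e1m fcmD fcmN.
    rewrite fcm_adj eT !(fcmM _ _ WW) e1m -fcmZ -fcmN -!fcmD; congr (qf (fcm W _) v).
    apply/boolp.funext => j.
    by rewrite -ss; field; rewrite gt_eqF.
  by rewrite qfB gerBl.
have : qf T v = qf (S' i) v + qf Q v by rewrite qfB addrC subrK.
move=> h3; have := BS' i v; have := QT; move: h3; rewrite qS' => h3 h1 h2.
have h4 : qf Q v <= \sum_(j | j != i) qf (S j) v + e * k * qf 1%:M v.
  apply: (@le_trans _ _ (\sum_(j | j != i) (qf (S j) v + e * qf 1%:M v))).
    rewrite qQ; apply: ler_sum => j _; rewrite qS'.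
    rewrite lerD2r; apply: ler_piMl; first exact: qS0.
    by rewrite gerBl; apply: ltW.
  rewrite big_split /= lerD2l sumr_const -mulr_natr mulrAC.
  apply: ler_wpM2r; first exact: q10.
  by rewrite ler_pM2l // ler_nat max_card.
rewrite (qfB 1%:M (S i)).
apply: (hayashi_nagaoka_arith (ltW e0) _ _ ek h3 h2 h1 h4); first exact: q10.
exact: S1.
Qed.

(** * Orthogonal projectors: union bound and pinching *)

Definition proj P := P^t* = P /\ P *m P = P.

Lemma qf_proj P v : proj P -> qf P v = qf 1%:M (P *m v).
Proof. by move=> [hP PP]; rewrite -qf_conj mulmx1 hP PP. Qed.

Lemma projC P : proj P -> proj (1%:M - P).
Proof.
move=> [hP PP]; split; first by rewrite adjB adj1 hP.
by rewrite mulmxBr mulmx1 mulmxBl PP mul1mx subrr subr0.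
Qed.

Lemma proj_le1 P : proj P -> leo P 1%:M.
Proof.
move=> pP v; rewrite -subr_ge0 -qfB qf_proj; first exact: qf1_ge0.
exact: projC.
Qed.

Lemma proj_contr P v : proj P -> qf 1%:M (P *m v) <= qf 1%:M v.
Proof. by move=> pP; rewrite -qf_proj //; apply: proj_le1. Qed.

Lemma proj_pos P : proj P -> pos P.
Proof. by move=> [hP PP]; exists P; rewrite hP PP. Qed.

Lemma young_arith1 (a x y c : R) :
  a ^+ 2 * x - a * c - (a * c - y) = a ^+ 2 * x - 2 * a * c + y.
Proof. by ring. Qed.

Lemma young_arith2 (t x y c : R) : 0 < t -> 0 <= y ->
  0 <= t ^+ 2 * x - 2 * t * c + y ->
  x - (1 ^+ 2 * x - 2 * 1 * c + y) <= t * x + t^-1 * y.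
Proof.
move=> t0 y0 h.
suff : 2 * c <= t * x + t^-1 * y by lra.
rewrite -(ler_pM2l t0) mulrDr !mulrA divff ?gt_eqF // mul1r; lra.
Qed.

(** The left side is 2 Re<v,w> - |w|^2, and |t v - w|^2 >= 0 bounds 2 Re<v,w> by t |v|^2 + |w|^2 /
    t. *)
Lemma qf1_young v w (t : R) : 0 < t ->
  qf 1%:M v - qf 1%:M (v - w) <= t * qf 1%:M v + t^-1 * qf 1%:M w.
Proof.
move=> t0; pose c := complex.Re ((v^t* *m w) 0 0).
have cc : complex.Re ((w^t* *m v) 0 0) = c.
  rewrite -[w^t* *m v](@trmxCK R[i]) adjM trmxCK mxE mxE Re_conj //.
have ex a : qf 1%:M (a%:C%C *: v - w) = a ^+ 2 * qf 1%:M v - 2 * a * c + qf 1%:M w.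
  have E (X Y Z U : 'M[C]_1) :
      complex.Re ((a%:C%C *: (a%:C%C *: X - Z) - (a%:C%C *: Y - U)) 0 0) =
      a ^+ 2 * complex.Re (X 0 0) - a * complex.Re (Z 0 0) -
      (a * complex.Re (Y 0 0) - complex.Re (U 0 0)).
    by rewrite !mxE !(ReD, ReN, ReZ) mulrDr mulrN mulrA expr2.
  rewrite /qf !mulmx1 adjB adjZ mulmxBl -scalemxAl !mulmxBr -2!scalemxAr E cc -/c.
  exact: young_arith1.
have := ex 1; rewrite scale1r => ->.
have := qf1_ge0 (t%:C%C *: v - w); rewrite ex => h.
exact: (young_arith2 t0 (qf1_ge0 w) h).
Qed.

Lemma union_arith (x y z s q1 q2 q3 : R) : 0 <= q3 -> s <= 2 * x + 2 * y ->
  x <= q2 -> y <= z -> z <= q1 -> 2 * q3 + 2 * s <= 4 * (q1 + q2 + q3).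
Proof. by lra. Qed.

(** The product equals Q^* Q with Q = P3 P2 P1, so the left side is |v|^2 - |Q v|^2, and [qf1_young]
    reduces the claim to the size of v - Q v. *)
Lemma projs_union_bound P1 P2 P3 (t : R) v : 0 < t ->
  proj P1 -> proj P2 -> proj P3 ->
  qf (1%:M - P1 *m P2 *m P3 *m P2 *m P1) v <= t * qf 1%:M v +
    4 / t * (qf (1%:M - P1) v + qf (1%:M - P2) v + qf (1%:M - P3) v).
Proof.
move=> t0 p1 p2 p3; set Q := P3 *m P2 *m P1; set w := v - Q *m v.
have -> : P1 *m P2 *m P3 *m P2 *m P1 = Q^t* *m 1%:M *m Q.
  by rewrite mulmx1 !adjM p1.1 p2.1 p3.1 !mulmxA -(mulmxA _ P3 P3) p3.2.
rewrite qfB qf_conj (_ : Q *m v = v - w); last by rewrite opprB addrC subrK.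
apply: le_trans (qf1_young _ _ t0) _; rewrite lerD2l (mulrC 4) -mulrA.
rewrite ler_pM2l ?invr_gt0 //.
(* Telescoping; the projectors in front of each difference only shrink it. *)
have -> : w = (v - P3 *m v) + (P3 *m (v - P2 *m v) + P3 *m (P2 *m (v - P1 *m v))).
  by rewrite !mulmxBr !mulmxA !addrA !subrK.
have n0 : leo 0 (1%:M : M) by move=> u; rewrite qf0 qf1_ge0.
apply: le_trans (qf_add_le _ _ n0) _.
have cc P : proj P -> qf 1%:M (v - P *m v) = qf (1%:M - P) v.
  by move=> /projC pP; rewrite (qf_proj _ pP) mulmxBl mul1mx.
rewrite (cc _ p3); apply: union_arith (qf_add_le _ _ n0) _ _ _.
- by rewrite (qf_proj _ (projC p3)); apply: qf1_ge0.
- by rewrite -(cc _ p2); apply: proj_contr.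
- exact: proj_contr.
- by rewrite -(cc _ p1); apply: proj_contr.
Qed.

(* From X <= 2 P X P + 2 (1 - P) X (1 - P). *)
Lemma ev_pinch P X D : proj P -> leo 0 X -> leo X 1%:M -> pos D ->
  ev X D <= 2 * ev X (P *m D *m P) + 2 * ev (1%:M - P) D.
Proof.
move=> pP X0 X1 pD; rewrite -ev_mulA -!evZl -evDl; apply: ev_mono pD => v.
rewrite qfD !qfZ -{1}pP.1 qf_conj {1}(_ : v = P *m v + (1%:M - P) *m v); last first.
  by rewrite -mulmxDl addrC subrK mul1mx.
apply: le_trans (qf_add_le _ _ X0) _; rewrite lerD2l ler_pM2l //.
by rewrite (qf_proj _ (projC pP)).
Qed.

(* From P X P <= 2 X + 2 (1 - P) X (1 - P). *)
Lemma ev_unpinch P X D : proj P -> leo 0 X -> leo X 1%:M -> pos D ->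
  ev X (P *m D *m P) <= 2 * ev X D + 2 * ev (1%:M - P) D.
Proof.
move=> pP X0 X1 pD; rewrite -ev_mulA -!evZl -evDl; apply: ev_mono pD => v.
rewrite qfD !qfZ -{1}pP.1 qf_conj (_ : P *m v = v - (1%:M - P) *m v); last first.
  by rewrite mulmxBl mul1mx opprB addrC subrK.
have := X0 (v + (1%:M - P) *m v); rewrite qf0 => h.
apply: (@le_trans _ _ (2 * qf X v + 2 * qf X ((1%:M - P) *m v))).
  by rewrite -qf_polar lerDr.
by rewrite lerD2l ler_pM2l // (qf_proj _ (projC pP)).
Qed.

End Measurement.

(** * Random codebooks and the one-shot error bound *)

Section Expectation.
Variable R : realType.

Definition Ex (T : finType) (w F : T -> R) : R := \sum_t w t * F t.

Variables (T : finType) (w : T -> R).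
Implicit Types F G : T -> R.

Lemma ExD F G : Ex w (fun t => F t + G t) = Ex w F + Ex w G.
Proof. by rewrite /Ex -big_split; apply: eq_bigr => t _; rewrite mulrDr. Qed.

Lemma ExZ a F : Ex w (fun t => a * F t) = a * Ex w F.
Proof. by rewrite /Ex mulr_sumr; apply: eq_bigr => t _; rewrite mulrCA. Qed.

Lemma Ex_sum (I : finType) (P : pred I) (F : I -> T -> R) :
  Ex w (fun t => \sum_(i | P i) F i t) = \sum_(i | P i) Ex w (F i).
Proof.
rewrite /Ex exchange_big; apply: eq_bigr => t _ /=.
by rewrite mulr_sumr.
Qed.

Lemma Ex_eq F G : F =1 G -> Ex w F = Ex w G.
Proof. by move=> FG; apply: eq_bigr => t _; rewrite FG. Qed.

Hypothesis w1 : isdist w.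

Lemma Ex_cst a : Ex w (fun=> a) = a.
Proof. by rewrite /Ex -mulr_suml w1.2 mul1r. Qed.

Lemma Ex_le F G : (forall t, F t <= G t) -> Ex w F <= Ex w G.
Proof. by move=> FG; apply: ler_sum => t _; apply: ler_wpM2l => //; apply: w1.1. Qed.

Lemma Ex_ub F a : (forall t, F t <= a) -> Ex w F <= a.
Proof. by move=> Fa; rewrite -[leRHS]Ex_cst; apply: Ex_le. Qed.

End Expectation.

Lemma Ex_swap (R : realType) (S T : finType) (v : S -> R) (w : T -> R) F :
  Ex v (fun s => Ex w (F s)) = Ex w (fun t => Ex v (F^~ t)).
Proof.
rewrite /Ex; under eq_bigr do rewrite mulr_sumr.
rewrite exchange_big; apply: eq_bigr => t _; rewrite mulr_sumr.
by apply: eq_bigr => s _; rewrite mulrCA.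
Qed.

Lemma sum_delta (S : nzRingType) (T : finType) (a : T) (F : T -> S) :
  \sum_t (t == a)%:R * F t = F a.
Proof.
rewrite (bigD1 a) //= eqxx mul1r big1 ?addr0 // => t /negbTE ->; exact: mul0r.
Qed.

(** * Random codebooks with independent codewords *)

Section Codebook.
Variables (R : realType) (A : finType) (q : A -> R) (m : nat).
Hypothesis q1 : isdist q.

Definition cbw (c : {ffun 'I_m -> A}) : R := \prod_i q (c i).

(** Independence of the codewords, obtained by distributing a product of sums over all codebooks;
    the marginals below are instances. *)
Lemma sum_cbw_prod (F : 'I_m -> A -> R) :
  \sum_c cbw c * \prod_i F i (c i) = \prod_i Ex q (F i).
Proof.
rewrite /Ex bigA_distr_bigA; apply: eq_bigr => c _.
by rewrite -big_split.
Qed.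

Lemma cbw_dist : isdist cbw.
Proof.
split=> [c|]; first by apply: prodr_ge0 => i _; apply: q1.1.
have := sum_cbw_prod (fun _ _ => 1).
rewrite (eq_bigr cbw) => [->|c _]; last by rewrite big1 ?mulr1.
by apply: big1 => i _; apply: Ex_cst.
Qed.

Lemma Ex_cbw1 i (F : A -> R) : Ex cbw (fun c => F (c i)) = Ex q F.
Proof.
have := sum_cbw_prod (fun j a => if j == i then F a else 1).
rewrite (bigD1 i) //= eqxx [X in _ * X]big1 ?mulr1; last first.
  by move=> j /negbTE ->; apply: Ex_cst.
move=> <-; apply: eq_bigr => c _; rewrite (bigD1 i) //= eqxx big1 ?mulr1 //.
by move=> j /negbTE ->.
Qed.

Lemma Ex_cbw2 i j (G : A -> A -> R) : i != j ->
  Ex cbw (fun c => G (c i) (c j)) = Ex q (fun a => Ex q (G a)).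
Proof.
move=> ij; have ji : (j == i) = false by rewrite eq_sym (negbTE ij).
(* [G] need not factor in its two arguments; fixing the value x of c i by an indicator restores the
   product form. *)
transitivity (\sum_x Ex cbw (fun c => (x == c i)%:R * G x (c j))).
  rewrite -Ex_sum; apply: Ex_eq => c; by rewrite sum_delta.
apply: eq_bigr => x _.
have := sum_cbw_prod (fun k a => if k == i then (x == a)%:R else
   if k == j then G x a else 1).
rewrite (bigD1 i) //= eqxx (bigD1 j) ?ji //= eqxx.
rewrite [X in _ * (_ * X)]big1 ?mulr1; last first.
  by move=> k /andP[/negbTE -> /negbTE ->]; apply: Ex_cst.
rewrite {1}/Ex (bigD1 x) //= eqxx mulr1 [X in q x + X]big1 ?addr0; last first.
  by move=> a; rewrite eq_sym => /negbTE ->; rewrite mulr0.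
move=> <-; apply: eq_bigr => c _; rewrite (bigD1 i) //= eqxx (bigD1 j) ?ji //=.
rewrite eqxx big1 ?mulr1 //.
by move=> k /andP[/negbTE -> /negbTE ->].
Qed.

End Codebook.

(** * One-shot error bound for abstract projectors *)

Section OneShot.
Variables (R : realType) (n : nat).
Local Notation M := 'M[R[i]]_n.
Variables (A1 A2 : finType) (q1 : A1 -> R) (q2 : A2 -> R).
Hypotheses (dq1 : isdist q1) (dq2 : isdist q2).
Variable rho : A1 -> A2 -> M.
Hypothesis rho_pos : forall a b, pos (rho a b).
Hypothesis rho_tr : forall a b, ev 1%:M (rho a b) = 1.

Definition avg1 a : M := \sum_b (q2 b)%:C%C *: rho a b.
Definition avg2 b : M := \sum_a (q1 a)%:C%C *: rho a b.
Definition avg12 : M := \sum_b (q2 b)%:C%C *: avg2 b.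

Lemma ev_avg2 X b : ev X (avg2 b) = Ex q1 (fun a => ev X (rho a b)).
Proof. by rewrite ev_sumr; apply: eq_bigr => a _; rewrite evZr. Qed.

Lemma ev_avg1 X a : ev X (avg1 a) = Ex q2 (fun b => ev X (rho a b)).
Proof. by rewrite ev_sumr; apply: eq_bigr => b _; rewrite evZr. Qed.

Lemma ev_avg12 X : ev X avg12 = Ex q2 (fun b => ev X (avg2 b)).
Proof. by rewrite ev_sumr; apply: eq_bigr => a _; rewrite evZr. Qed.

Variables (P0 : M) (P1 : A1 -> M) (P2 : A2 -> M) (P12 : A1 -> A2 -> M).
Hypotheses (pP0 : proj P0) (pP1 : forall a, proj (P1 a)).
Hypotheses (pP2 : forall b, proj (P2 b)) (pP12 : forall a b, proj (P12 a b)).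
Variables (k l0 l1 l2 : R).
Hypothesis k0 : 0 <= k.
Hypothesis l00 : 0 <= l0.
Hypothesis l10 : 0 <= l1.
Hypothesis l20 : 0 <= l2.
Hypothesis h12 : forall a b, leo (P12 a b) (k%:C%C *: rho a b).
Hypothesis h2 : forall b, leo (P2 b *m avg2 b *m P2 b) (l2%:C%C *: 1%:M).
Hypothesis h2' : forall b, leo (P2 b *m avg2 b *m P2 b) (avg2 b).
Hypothesis h1 : forall a, leo (P1 a *m avg1 a *m P1 a) (l1%:C%C *: 1%:M).
Hypothesis h0 : leo (P0 *m avg12 *m P0) (l0%:C%C *: 1%:M).

Definition test a b : M := P0 *m P1 a *m P12 a b *m P1 a *m P0.
Definition pinched a b : M := P2 b *m rho a b *m P2 b.

Lemma testE a b :
  test a b = (P1 a *m P0)^t* *m P12 a b *m (P1 a *m P0).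
Proof. by rewrite adjM (pP1 a).1 pP0.1 /test !mulmxA. Qed.

Lemma test_pos a b : pos (test a b).
Proof.
rewrite testE -{2}[P1 a *m P0](@trmxCK R[i]); apply/pos_conj/proj_pos/pP12.
Qed.

Lemma test_le1 a b : leo (test a b) 1%:M.
Proof.
move=> v; rewrite testE qf_conj; apply: le_trans (proj_le1 (pP12 a b) _) _.
by rewrite -mulmxA; apply: le_trans (proj_contr _ (pP1 a)) (proj_contr _ pP0).
Qed.

Lemma test_le a b : leo (test a b)
  (k%:C%C *: ((P1 a *m P0)^t* *m rho a b *m (P1 a *m P0))).
Proof.
by move=> v; rewrite testE qfZ !qf_conj -qfZ; apply: h12.
Qed.

Lemma pinched_pos a b : pos (pinched a b).
Proof. by rewrite /pinched -{2}(pP2 b).1; apply: pos_conj. Qed.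

Lemma pinched_tr a b : ev 1%:M (pinched a b) <= 1.
Proof.
rewrite -ev_mulA mulmx1 (pP2 b).2 -[leRHS](rho_tr a b).
by apply: ev_mono (rho_pos a b); apply: proj_le1.
Qed.

(** By cyclicity this is Tr P12 P1 <= k Tr rho P1 <= k. *)
Lemma test_tr a b : ev 1%:M (P1 a *m P12 a b *m P1 a) <= k.
Proof.
rewrite evC ev_mulA mulmx1 (pP1 a).2.
apply: le_trans (ev_mono (h12 a b) (proj_pos (pP1 a))) _.
rewrite evZl -[leRHS]mulr1; apply: ler_wpM2l => //; rewrite -(rho_tr a b) evC.
by apply: ev_mono (rho_pos a b); apply: proj_le1.
Qed.

Lemma test_tr' a b : ev 1%:M (test a b) <= k.
Proof.
apply: le_trans (test_tr a b).
rewrite /test -(mulmxA P0) -(mulmxA P0) -ev_mulA mulmx1 pP0.2.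
apply: ev_mono; first exact: proj_le1.
by rewrite -{2}(pP1 a).1; apply/pos_conj/proj_pos/pP12.
Qed.

Definition cross a' b' a b := ev (test a' b') (pinched a b).

Lemma Ex_pinched X b : Ex q1 (fun a => ev X (pinched a b)) =
  ev X (P2 b *m avg2 b *m P2 b).
Proof.
rewrite -ev_mulA ev_avg2; apply: Ex_eq => a.
by rewrite /pinched -ev_mulA.
Qed.

(* m1 wrong, m2 right: averaging over the sent a first exposes P2 avg2 P2 <= l2. *)
Lemma cross_wrong1 a' b : Ex q1 (fun a => cross a' b a b) <= l2 * k.
Proof.
rewrite Ex_pinched evC; apply: le_trans (ev_mono (h2 b) (test_pos _ _)) _.
by rewrite evZl; apply: ler_wpM2l => //; apply: test_tr'.
Qed.

(* m1 right, m2 wrong: P1 avg1 P1 can only appear after averaging over the wrong b',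
   once P12 has been replaced by k rho. *)
Lemma cross_wrong2 a b : Ex q2 (fun b' => cross a b' a b) <= l1 * k.
Proof.
apply: (@le_trans _ _ (Ex q2 (fun b' =>
    k * ev ((P1 a *m P0)^t* *m rho a b' *m (P1 a *m P0)) (pinched a b)))).
  apply: Ex_le => // b'; rewrite -evZl.
  by apply: ev_mono; [exact: test_le|exact: pinched_pos].
rewrite ExZ mulrC; apply: ler_wpM2r => //.
have lin (K L D : M) : Ex q2 (fun b' => ev (K *m rho a b' *m L) D) =
    ev (K *m avg1 a *m L) D.
  by rewrite ev_mulA evC ev_avg1; apply: Ex_eq => b'; rewrite ev_mulA evC.
rewrite lin (_ : _ *m _ *m _ = P0^t* *m (P1 a *m avg1 a *m P1 a) *m P0); last first.
  by rewrite adjM (pP1 a).1 !mulmxA.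
apply: le_trans (ev_mono (leo_conj P0 (h1 a)) (pinched_pos a b)) _.
rewrite -scalemxAr -scalemxAl mulmx1 pP0.1 pP0.2 evZl -[leRHS]mulr1.
apply: ler_wpM2l => //; apply: le_trans (pinched_tr a b).
by apply: ev_mono; [exact: proj_le1|exact: pinched_pos].
Qed.

(* Both wrong: h2' removes the pinching and leaves P0 avg12 P0 <= l0. *)
Lemma cross_wrong12 a' b' :
  Ex q2 (fun b => Ex q1 (fun a => cross a' b' a b)) <= l0 * k.
Proof.
apply: (@le_trans _ _ (Ex q2 (fun b => ev (test a' b') (avg2 b)))).
  apply: Ex_le => // b; rewrite Ex_pinched evC [leRHS]evC.
  by apply: ev_mono; [exact: h2'|exact: test_pos].
rewrite -ev_avg12 /test -(mulmxA P0) -(mulmxA P0) ev_mulA evC.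
apply: le_trans (ev_mono h0 _) _.
  by rewrite -{2}(pP1 a').1; apply/pos_conj/proj_pos/pP12.
by rewrite evZl; apply: ler_wpM2l => //; apply: test_tr.
Qed.

Variables (M1 M2 : nat).
Hypotheses (M10 : (0 < M1)%N) (M20 : (0 < M2)%N).
Variables (t eps : R).
Hypotheses (t0 : 0 < t) (eps0 : 0 < eps).

(** The share of the error that depends on the sent pair alone. Pinching, Hayashi-Nagaoka,
    unpinching and the union bound are chained: 10 = 2 + 2 * 2 * 2 and 32 = 2 * 2 * 2 * 4. *)
Definition local_err a b : R :=
  10 * ev (1%:M - P2 b) (rho a b) + (8 * t + 2 * eps) +
  32 / t * (ev (1%:M - P0) (rho a b) + ev (1%:M - P1 a) (rho a b) +
            ev (1%:M - P12 a b) (rho a b)).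

Lemma local_arith (x0 x1 x2 x3 x4 x5 e0 e1 e2 e12 s : R) : x5 <= 1 ->
  x0 <= 2 * x1 + 2 * e2 -> x1 <= 2 * x3 + 4 * s + eps * x5 ->
  x3 <= 2 * x4 + 2 * e2 -> x4 <= t * 1 + 4 / t * (e0 + e1 + e12) ->
  x0 <= 10 * e2 + (8 * t + 2 * eps) + 32 / t * (e0 + e1 + e12) + 8 * s.
Proof.
move=> h5 h0' h1' h3 h4; have : eps * x5 <= eps * 1 by rewrite ler_pM2l.
rewrite (_ : 32 / t = 8 * (4 / t)); last by rewrite mulrA; congr (_ / _); ring.
by move: (4 / t) (e0 + e1 + e12) h4 => u w h4 h6; nra.
Qed.

(** For fixed codebooks, the sent state is pinched before Hayashi-Nagaoka is applied, so the cross
    terms see the pinched state; the term 1 - S_m is then moved back to the original state. *)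
Lemma decoder (c1 : 'I_M1 -> A1) (c2 : 'I_M2 -> A2) :
  exists L : 'I_M1 * 'I_M2 -> M,
    [/\ forall m, pos (L m), \sum_m L m = 1%:M &
     forall m, ev (1%:M - L m) (rho (c1 m.1) (c2 m.2)) <=
       local_err (c1 m.1) (c2 m.2) +
       8 * \sum_(j | j != m) cross (c1 j.1) (c2 j.2) (c1 m.1) (c2 m.2)].
Proof.
pose S (m : 'I_M1 * 'I_M2) := test (c1 m.1) (c2 m.2).
have [L [L0 L1 HL]] := hayashi_nagaoka (Ordinal M10, Ordinal M20) eps0
  (fun m => test_pos (c1 m.1) (c2 m.2)) (fun m => test_le1 (c1 m.1) (c2 m.2)).
exists L; split=> // m; set a := c1 m.1; set b := c2 m.2.
have XL0 : leo 0 (1%:M - L m).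
  rewrite -L1 (bigD1 m isT) /= addrAC subrr add0r => v; rewrite qf_sum qf0.
  by apply: sumr_ge0 => j _; rewrite -(qf0 v); apply/pos_ge0.
have XL1 : leo (1%:M - L m) 1%:M.
  by move=> v; rewrite qfB gerBl -(qf0 v); apply/pos_ge0.
have XS0 : leo 0 (1%:M - test a b).
  by move=> v; rewrite qf0 qfB subr_ge0; apply: test_le1.
have XS1 : leo (1%:M - test a b) 1%:M.
  by move=> v; rewrite qfB gerBl -(qf0 v); apply/pos_ge0/test_pos.
have g1 := ev_pinch (pP2 b) XL0 XL1 (rho_pos a b).
have g3 := ev_unpinch (pP2 b) XS0 XS1 (rho_pos a b).
have g2 : ev (1%:M - L m) (pinched a b) <= 2 * ev (1%:M - test a b) (pinched a b) +
    4 * (\sum_(j | j != m) cross (c1 j.1) (c2 j.2) a b) +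
    eps * ev 1%:M (pinched a b).
  rewrite -ev_suml -!evZl -!evDl; apply: ev_mono (pinched_pos a b) => v.
  by rewrite [leRHS]qfD [X in _ <= X + _]qfD !qfZ qf_sum; apply: HL.
have g4 : ev (1%:M - test a b) (rho a b) <= t * ev 1%:M (rho a b) + 4 / t *
    (ev (1%:M - P0) (rho a b) + ev (1%:M - P1 a) (rho a b) +
     ev (1%:M - P12 a b) (rho a b)).
  rewrite -!evDl -!evZl -evDl; apply: ev_mono (rho_pos a b) => v.
  rewrite [leRHS]qfD !qfZ [X in 4 / t * X]qfD [X in 4 / t * (X + _)]qfD.
  exact: projs_union_bound.
rewrite rho_tr in g4.
exact: local_arith (pinched_tr a b) g1 g2 g3 g4.
Qed.

Variable eta : R.
Hypothesis e0 : ev (1%:M - P0) avg12 <= eta.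
Hypothesis e1 : Ex q1 (fun a => ev (1%:M - P1 a) (avg1 a)) <= eta.
Hypothesis e2 : Ex q2 (fun b => ev (1%:M - P2 b) (avg2 b)) <= eta.
Hypothesis e12 :
  Ex q1 (fun a => Ex q2 (fun b => ev (1%:M - P12 a b) (rho a b))) <= eta.

Lemma Ex_arith (c x0 x1 x2 x12 : R) : x2 <= eta -> x0 <= eta -> x1 <= eta ->
  x12 <= eta ->
  10 * x2 + c + 32 / t * (x0 + x1 + x12) <= 10 * eta + c + 32 / t * (3 * eta).
Proof.
move=> h2_ h0_ h1_ h12_; have : 32 / t * (x0 + x1 + x12) <= 32 / t * (3 * eta).
  by rewrite ler_pM2l ?divr_gt0 //; lra.
by lra.
Qed.

(** Averaging over the codewords on which a projector does not depend turns [rho] into [avg1],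
    [avg2] or [avg12]. *)
Lemma Ex_local : Ex q1 (fun a => Ex q2 (local_err a)) <=
  10 * eta + (8 * t + 2 * eps) + 32 / t * (3 * eta).
Proof.
have s2 : Ex q1 (fun a => Ex q2 (fun b => ev (1%:M - P2 b) (rho a b))) <= eta.
  by rewrite Ex_swap; under Ex_eq => b do rewrite -ev_avg2.
have s1 : Ex q1 (fun a => Ex q2 (fun b => ev (1%:M - P1 a) (rho a b))) <= eta.
  by under Ex_eq => b do rewrite -ev_avg1.
have s0 : Ex q1 (fun a => Ex q2 (fun b => ev (1%:M - P0) (rho a b))) <= eta.
  by rewrite Ex_swap; under Ex_eq => b do rewrite -ev_avg2; rewrite -ev_avg12.
rewrite /local_err.
under Ex_eq => a do rewrite 2!ExD 2!ExZ 2!ExD (Ex_cst dq2).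
rewrite 2!ExD 2!ExZ 2!ExD (Ex_cst dq1).
exact: (Ex_arith _ s2 s0 s1 e12).
Qed.

(** Equal indices share a codeword and distinct ones give independent codewords, so each of the
    three error patterns reduces to its own bound on [cross]. *)
Lemma Ex_cross (m j : 'I_M1 * 'I_M2) : j != m ->
  Ex (@cbw _ _ q1 M1) (fun c1 => Ex (@cbw _ _ q2 M2) (fun c2 =>
    cross (c1 j.1) (c2 j.2) (c1 m.1) (c2 m.2))) <=
  (if j.1 == m.1 then l1 * k else if j.2 == m.2 then l2 * k else l0 * k).
Proof.
case: m j => m1 m2 [j1 j2]; rewrite xpair_eqE /=.
have [->|j1m] := eqVneq j1 m1 => /= [j2m|].
  rewrite (Ex_cbw1 dq1 m1
    (fun a => Ex (@cbw _ _ q2 M2) (fun c2 => cross a (c2 j2) a (c2 m2)))).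
  apply: Ex_ub => // a.
  rewrite (Ex_cbw2 dq2 (fun b' b => cross a b' a b)) // Ex_swap.
  by apply: Ex_ub => // b; apply: cross_wrong2.
have [->|j2m] := eqVneq j2 m2 => /= _.
  under Ex_eq => c1.
    rewrite (Ex_cbw1 dq2 m2 (fun b => cross (c1 j1) b (c1 m1) b)).
    over.
  rewrite (Ex_cbw2 dq1 (fun a' a => Ex q2 (fun b => cross a' b a b))) //.
  apply: Ex_ub => // a'; rewrite Ex_swap.
  by apply: Ex_ub => // b; apply: cross_wrong1.
under Ex_eq => c1.
  rewrite (Ex_cbw2 dq2 (fun b' b => cross (c1 j1) b' (c1 m1) b)) //.
  over.
rewrite (Ex_cbw2 dq1 (fun a' a => Ex q2 (fun b' => Ex q2 (cross a' b' a)))) //.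
apply: Ex_ub => // a'; rewrite Ex_swap; apply: Ex_ub => // b'.
by rewrite Ex_swap; apply: cross_wrong12.
Qed.

Theorem one_shot : exists L : {ffun 'I_M1 -> A1} -> {ffun 'I_M2 -> A2} ->
    'I_M1 * 'I_M2 -> M,
  [/\ forall c1 c2 m, pos (L c1 c2 m), forall c1 c2, \sum_m L c1 c2 m = 1%:M &
    forall m, Ex (@cbw _ _ q1 M1) (fun c1 => Ex (@cbw _ _ q2 M2) (fun c2 =>
       ev (1%:M - L c1 c2 m) (rho (c1 m.1) (c2 m.2)))) <=
     10 * eta + (8 * t + 2 * eps) + 32 / t * (3 * eta) +
     8 * (M2.-1%:R * (l1 * k) + M1.-1%:R * (l2 * k + M2.-1%:R * (l0 * k)))].
Proof.
(* Choice selects one decoder for each pair of codebooks. *)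
pose L (c1 : {ffun 'I_M1 -> A1}) (c2 : {ffun 'I_M2 -> A2}) :=
  sval (boolp.cid (decoder c1 c2)).
have HL c1 c2 := svalP (boolp.cid (decoder c1 c2)).
exists L; split=> [c1 c2|c1 c2|m]; [by case: (HL c1 c2)|by case: (HL c1 c2)|].
pose G c1 c2 := local_err (c1 m.1) (c2 m.2) +
       8 * \sum_(j | j != m) cross (c1 j.1) (c2 j.2) (c1 m.1) (c2 m.2).
apply: (@le_trans _ _ (Ex (@cbw _ _ q1 M1) (fun c1 => Ex (@cbw _ _ q2 M2) (G c1)))).
  apply: Ex_le => [|c1]; first exact: cbw_dist.
  apply: Ex_le => [|c2]; first exact: cbw_dist.
  by case: (HL c1 c2) => _ _; apply.
under Ex_eq => c1 do rewrite ExD ExZ Ex_sum.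
rewrite ExD ExZ Ex_sum; apply: lerD.
  rewrite (Ex_cbw1 dq1 m.1
    (fun a => Ex (@cbw _ _ q2 M2) (fun c2 => local_err a (c2 m.2)))).
  by under Ex_eq => a do rewrite (Ex_cbw1 dq2 m.2 (local_err a)); exact: Ex_local.
rewrite ler_pM2l //; apply: le_trans (ler_sum _ (fun j => @Ex_cross m j)) _.
case: m {G} => m1 m2 /=.
rewrite -(pair_big_dep xpredT (fun j1 j2 => (j1, j2) != (m1, m2))
  (fun j1 j2 => if j1 == m1 then l1 * k else if j2 == m2 then l2 * k else l0 * k)) /=.
(* The row j1 = m1 holds M2 - 1 wrong pairs; each other row holds one pair with j2 = m2 and M2 - 1
   pairs with both messages wrong. *)
rewrite (bigD1 m1) //=; apply: lerD.
  under eq_bigl => j do rewrite xpair_eqE eqxx /=.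
  under eq_bigr => j _ do rewrite eqxx.
  by rewrite sumr_const cardC1 card_ord mulr_natl.
under eq_bigr => j jm.
  under eq_bigl => j' do rewrite xpair_eqE (negbTE jm) /=.
  under eq_bigr => j' _ do rewrite (negbTE jm).
  rewrite (bigD1 m2) //= eqxx.
  under eq_bigr => j' /negbTE j'm do rewrite j'm.
  rewrite sumr_const cardC1 card_ord -(mulr_natl (l0 * k)).
  over.
by rewrite sumr_const cardC1 card_ord -[leLHS]mulr_natl.
Qed.

End OneShot.

(** * Eigenbases and entropies *)

Section Spectra.
Variable R : realType.
Local Notation C := R[i].
Local Notation op := (op R).

(* The columns of W are an orthonormal eigenbasis of A, with eigenvalues f. *)
Definition spec (T : finType) (A W : op T) (f : T -> R) : Prop :=
  (forall s t, A s t = \sum_j W s j * (f j)%:C%C * (W t j)^*) /\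
  (forall i j, \sum_s (W s i)^* * W s j = (i == j)%:R).

Lemma sum_enum_val (T : finType) (V : nmodType) (F : T -> V) :
  \sum_(i < #|T|) F (enum_val i) = \sum_t F t.
Proof.
by rewrite [RHS](reindex_onto enum_val enum_rank) => [|i _]; rewrite ?enum_rankK //;
  apply: eq_bigl => i; rewrite enum_valK eqxx.
Qed.

Lemma spec_unitary (T : finType) (A W : op T) f : spec A W f ->
  (opmx W)^t* *m opmx W = 1%:M.
Proof.
move=> [_ WW]; apply/matrixP => i j; rewrite !mxE.
under eq_bigr do rewrite !mxE.
by rewrite (sum_enum_val (fun s => (W s _)^* * W s _)) WW (inj_eq enum_val_inj).
Qed.

Lemma spec_opmx (T : finType) (A W : op T) f : spec A W f ->
  opmx A = fcm (opmx W) (fun i => f (enum_val i)).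
Proof.
move=> [eA _]; apply/matrixP => i j; rewrite /fcm mul_mx_diag !mxE eA.
rewrite -(sum_enum_val (fun u => W _ u * (f u)%:C%C * (W _ u)^*)).
by apply: eq_bigr => k _; rewrite !mxE.
Qed.

Lemma psd_spec (T : finType) (A : op T) : psd A ->
  exists W f, spec A W f /\ forall t, 0 <= f t.
Proof.
move=> [hA pA]; have hM : (opmx A)^t* = opmx A.
  by apply/matrixP => i j; rewrite !mxE [RHS]hA.
have [W [f [eA WW _]]] := spectral_herm hM.
have f0 i : 0 <= f i.
  rewrite -(qf_fcm_col f i WW) -eA /qf.
  have := pA (fun t => W (enum_rank t) i); rewrite lecE => /andP[_ /=].
  move=> h; apply: le_trans h _; rewrite le_eqVlt; apply/orP; left; apply/eqP.
  congr complex.Re.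
  rewrite -mulmxA mxE -sum_enum_val; apply: eq_bigr => k _.
  rewrite !mxE enum_valK -sum_enum_val mulr_sumr; apply: eq_bigr => l _.
  by rewrite !mxE enum_valK mulrA.
exists (fun s t => W (enum_rank s) (enum_rank t)), (fun t => f (enum_rank t)).
split=> //; split=> [s t|i j].
  have := congr1 (fun B : 'M_#|T| => B (enum_rank s) (enum_rank t)) eA.
  rewrite /fcm mul_mx_diag !mxE !enum_rankK => ->; rewrite -[RHS]sum_enum_val.
  by apply: eq_bigr => k _; rewrite !mxE enum_valK.
have := congr1 (fun B : 'M_#|T| => B (enum_rank i) (enum_rank j)) WW.
rewrite !mxE (inj_eq enum_rank_inj) => <-; rewrite -[LHS]sum_enum_val.
by apply: eq_bigr => k _; rewrite !mxE enum_valK.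
Qed.

Lemma spec_trace (T : finType) (A W : op T) f : spec A W f ->
  trace A = (\sum_t f t)%:C%C.
Proof.
move=> [eA WW]; rewrite /trace; under eq_bigr do rewrite eA.
rewrite exchange_big rmorph_sum; apply: eq_bigr => j _ /=.
transitivity ((f j)%:C%C * \sum_i (W i j)^* * W i j).
  by rewrite mulr_sumr; apply: eq_bigr => i _; rewrite mulrAC mulrC [_ * _^*]mulrC.
by rewrite WW eqxx mulr1.
Qed.

(** Similar matrices share their characteristic polynomial; the similarity is carried out over
    polynomial matrices. *)
Lemma char_poly_fcm n (W : 'M[C]_n) f : W^t* *m W = 1%:M ->
  char_poly (fcm W f) = \prod_i ('X - ((f i)%:C%C)%:P).
Proof.
move=> WW; pose D := diag_mx (\row_i (f i)%:C%C : 'rV[C]_n).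
transitivity (char_poly D); last first.
  rewrite char_poly_trig; last exact/diag_mx_is_trig.
  by apply: eq_bigr => i _; rewrite !mxE eqxx.
pose P : 'M[{poly C}]_n := map_mx polyC W; pose Q := map_mx polyC (W^t*).
have QP : Q *m P = 1%:M by rewrite -map_mxM WW map_mx1.
have PQ : P *m Q = 1%:M by apply: mulmx1C.
have -> : char_poly (fcm W f) = \det (P *m char_poly_mx D *m Q).
  rewrite /char_poly /char_poly_mx mulmxBr mulmxBl mul_mx_scalar -scalemxAl PQ.
  by rewrite scalemx1 -!map_mxM.
by rewrite !det_mulmx mulrAC -det_mulmx PQ det1 mul1r.
Qed.

(** [eigs] is an unspecified list of roots, but linear factorizations are unique up to permutation,
    so any eigenbasis computes the entropy. *)
Lemma vnH_spec (T : finType) (A W : op T) f : spec A W f ->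
  vnH A = - \sum_t f t * log2 (f t).
Proof.
move=> sA; have WW := spec_unitary sA; rewrite /vnH; congr (- _).
rewrite -(sum_enum_val (fun t => f t * log2 (f t))) /eigs.
case: closed_field_poly_normal => r /=.
rewrite (monicP (char_poly_monic _)) scale1r (spec_opmx sA) char_poly_fcm //.
rewrite -(big_map (fun i => (f (enum_val i))%:C%C) xpredT (fun x => 'X - x%:P)).
move=> /prod_XsubC_eq pr; rewrite -(perm_big _ pr) big_map.
by rewrite /index_enum -enumT.
Qed.

Lemma density_spec (T : finType) (A : op T) : density A ->
  exists W f, spec A W f /\ isdist f.
Proof.
move=> [/psd_spec[W [f [sA f0]]] trA]; exists W, f; split=> //; split=> //.
by move: trA; rewrite (spec_trace sA) => /(congr1 (@complex.Re R)).
Qed.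

Lemma eq_vnH (T : finType) (A B : op T) : (forall s t, A s t = B s t) -> vnH A = vnH B.
Proof.
move=> AB; rewrite /vnH (_ : opmx A = opmx B) //.
by apply/matrixP => i j; rewrite !mxE.
Qed.

Definition shannon (X : finType) (p : X -> R) : R := - \sum_x p x * log2 (p x).

Definition dop (X : finType) (p : X -> R) : op X :=
  fun s t => (s == t)%:R * (p s)%:C%C.

Definition cqop (X B : finType) (p : X -> R) (F : X -> op B) : op (X * B)%type :=
  fun s t => (s.1 == t.1)%:R * (p s.1)%:C%C * F s.1 s.2 t.2.

Lemma vnH_dop (X : finType) (p : X -> R) : vnH (dop p) = shannon p.
Proof.
apply: (@vnH_spec _ _ (@idop R X)); split=> [s t|i j]; rewrite /idop /dop.
  under eq_bigr => j _ do rewrite eq_sym -mulrA.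
  by rewrite sum_delta conjC_nat mulrC eq_sym.
under eq_bigr => s _ do rewrite conjC_nat.
by rewrite sum_delta.
Qed.

Lemma log2M (x y : R) : 0 < x -> 0 < y -> log2 (x * y) = log2 x + log2 y.
Proof. by move=> x0 y0; rewrite /log2 lnM ?posrE // mulrDl. Qed.

Lemma xlog2M (x y : R) : 0 <= x -> 0 <= y ->
  x * y * log2 (x * y) = y * (x * log2 x) + x * (y * log2 y).
Proof.
rewrite le_eqVlt => /predU1P[<-|x0]; first by rewrite !(mul0r, mulr0, addr0).
rewrite le_eqVlt => /predU1P[<-|y0]; first by rewrite !(mul0r, mulr0, addr0).
by rewrite log2M //; ring.
Qed.

(** The eigenvalues are the products p x * f x k, whose logarithms split; this is the chain rule
    that makes H(B|X) an average of entropies. *)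
Lemma vnH_cqop (X B : finType) (p : X -> R) (F : X -> op B) :
  isdist p -> (forall x, density (F x)) ->
  vnH (cqop p F) = shannon p + Ex p (fun x => vnH (F x)).
Proof.
move=> [p0 p1] dF.
have [W WP] := boolp.choice (fun x => density_spec (dF x)).
have [f fP] := boolp.choice WP.
(* Column (x, k) is |x> tensored with the k-th eigenvector of F x. *)
pose V : op (X * B)%type := fun s j => (j.1 == s.1)%:R * W s.1 s.2 j.2.
rewrite (@vnH_spec _ _ V (fun j => p j.1 * f j.1 j.2)); last first.
  split=> [[x s] [y t]|[x i] [y j]]; rewrite /cqop /V /=.
    rewrite -(pair_bigA _ (fun z k => (z == x)%:R * W x s k * (p z * f z k)%:C%C *
      ((z == y)%:R * W y t k)^*)) /=.
    under eq_bigr => z _ do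
      (under eq_bigr => k _ do rewrite -!mulrA; rewrite -mulr_sumr).
    rewrite sum_delta; have [<-|_] := eqVneq x y.
      rewrite mul1r (fP x).1.1 mulr_sumr; apply: eq_bigr => k _.
      by rewrite mul1r rmorphM /=; ring.
    rewrite !mul0r big1 // => k _; by rewrite mul0r conjC0 !mulr0.
  rewrite -(pair_bigA _ (fun z k => ((x == z)%:R * W z k i)^* *
      ((y == z)%:R * W z k j))) /=.
  transitivity (\sum_z (z == x)%:R * ((y == z)%:R * \sum_k (W z k i)^* * W z k j)).
    apply: eq_bigr => z _; rewrite !mulr_sumr; apply: eq_bigr => k _.
    by rewrite rmorphM /= conjC_nat (eq_sym x z); ring.
  rewrite sum_delta (fP x).1.2 xpair_eqE eq_sym.
  by case: (x == y); rewrite /= ?mul1r ?mul0r.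
rewrite -(pair_bigA _ (fun x b => p x * f x b * log2 (p x * f x b))) /=.
rewrite /shannon /Ex -!sumrN -big_split; apply: eq_bigr => x _ /=.
under eq_bigr => b _ do rewrite xlog2M ?(fP x).2.1 //.
rewrite big_split /= -mulr_suml (fP x).2.2 mul1r -mulr_sumr.
by rewrite (vnH_spec (fP x).1) mulrN opprD.
Qed.

End Spectra.

(** * Typical projectors *)

Section Tuples.

Lemma sum_tuple_ffun (V : nmodType) (A : finType) n (F : n.-tuple A -> V) :
  \sum_t F t = \sum_(c : {ffun 'I_n -> A}) F (tuple_of_finfun c).
Proof.
rewrite (reindex (@tuple_of_finfun A n)) //.
by exists (@finfun_of_tuple A n) => x _; rewrite ?tuple_of_finfunK ?finfun_of_tupleK.
Qed.

Lemma tnth_tuple_of_finfun (A : Type) n (c : {ffun 'I_n -> A}) k :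
  tnth (tuple_of_finfun c) k = c k.
Proof. by rewrite -[c in RHS](@tuple_of_finfunK A n) ffunE. Qed.

Lemma sum_tuple_prod (S : comNzRingType) (A : finType) n (F : 'I_n -> A -> S) :
  \sum_(t : n.-tuple A) \prod_k F k (tnth t k) = \prod_k \sum_a F k a.
Proof.
rewrite bigA_distr_bigA sum_tuple_ffun; apply: eq_bigr => c _.
by apply: eq_bigr => k _; rewrite tnth_tuple_of_finfun.
Qed.

Definition ztuple (A B : Type) n (a : n.-tuple A) (b : n.-tuple B) : n.-tuple (A * B) :=
  [tuple (tnth a k, tnth b k) | k < n].

Lemma sum_ztuple (V : nmodType) (A B : finType) n (F : n.-tuple (A * B) -> V) :
  \sum_t F t = \sum_a \sum_b F (ztuple a b).
Proof.
rewrite pair_bigA (reindex (fun ab => ztuple ab.1 ab.2)) //.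
exists (fun z => ([tuple (tnth z k).1 | k < n], [tuple (tnth z k).2 | k < n])).
  by move=> [a b] _; congr pair; apply: eq_from_tnth => k; rewrite !tnth_mktuple.
move=> z _; apply: eq_from_tnth => k; rewrite !tnth_mktuple.
by case: (tnth z k).
Qed.

End Tuples.

(** * Weak law of large numbers *)

Section LargeNumbers.
Variable R : realType.

Definition tupw (A : finType) (p : A -> R) n (t : n.-tuple A) : R :=
  \prod_k p (tnth t k).

Lemma Ex_tupw (A : finType) (p : A -> R) n (F : n.-tuple A -> R) :
  Ex (@tupw _ p n) F = Ex (@cbw _ _ p n) (fun c => F (tuple_of_finfun c)).
Proof.
rewrite /Ex sum_tuple_ffun; apply: eq_bigr => c _; congr (_ * _).
by apply: eq_bigr => k _; rewrite tnth_tuple_of_finfun.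
Qed.

Lemma tupw_dist (A : finType) (p : A -> R) n : isdist p -> isdist (@tupw _ p n).
Proof.
move=> [p0 p1]; split=> [t|]; first by apply: prodr_ge0 => k _; apply: p0.
by rewrite /tupw (sum_tuple_prod (fun=> p)); apply: big1.
Qed.

Variables (Z : finType) (q : Z -> R).
Hypothesis dq : isdist q.

Lemma chebyshev n (g : Z -> R) (d : R) : Ex q g = 0 -> 0 < d ->
  Ex (@tupw _ q n.+1) (fun z => (~~ (`|\sum_k g (tnth z k)| <= n.+1%:R * d))%:R) <=
  Ex q (fun z => g z ^+ 2) / (n.+1%:R * d ^+ 2).
Proof.
move=> g0 d0; set m := n.+1; have m0 : 0 < m%:R :> R by rewrite ltr0n.
have md0 : 0 < m%:R * d by rewrite mulr_gt0.
(* Off-diagonal terms of the square vanish by independence and mean zero. *)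
have second : Ex (@tupw _ q m) (fun z => (\sum_k g (tnth z k)) ^+ 2) =
    m%:R * Ex q (fun z => g z ^+ 2).
  rewrite Ex_tupw (Ex_eq _ (G := fun c : {ffun 'I_m -> Z} => \sum_(i < m) \sum_(j < m) g (c i) * g (c j))).
    rewrite Ex_sum (eq_bigr (fun=> Ex q (fun z => g z ^+ 2))).
      by rewrite sumr_const card_ord mulr_natl.
    move=> i _; rewrite Ex_sum (bigD1 i) //= big1 ?addr0.
      by rewrite (Ex_cbw1 dq i (fun z => g z * g z)); apply: Ex_eq => z; rewrite expr2.
    move=> j ji; rewrite (Ex_cbw2 dq (fun a b => g a * g b)) 1?eq_sym //.
    rewrite (Ex_eq _ (G := fun=> 0)) ?Ex_cst // => a.
    by rewrite ExZ g0 mulr0.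
  move=> c; rewrite expr2 mulr_suml; apply: eq_bigr => i _.
  by rewrite mulr_sumr; apply: eq_bigr => j _; rewrite !tnth_tuple_of_finfun.
rewrite ler_pdivlMr ?mulr_gt0 ?exprn_gt0 // -(ler_pM2r m0) [leRHS]mulrC -second.
rewrite -[leLHS]mulrA [leLHS]mulrC -ExZ; apply: Ex_le => [|z]; first exact: tupw_dist.
case: (leP `|\sum_k g (tnth z k)| (m%:R * d)) => [_|lt]; first by rewrite mulr0 sqr_ge0.
rewrite mulr1 -[leRHS]real_normK ?num_real // (_ : m%:R * d ^+ 2 * m%:R = (m%:R * d) ^+ 2); last by ring.
by rewrite lerXn2r // ?nnegrE ?ltW.
Qed.

Lemma weak_law (f : Z -> R) (d eta : R) : 0 < d -> 0 < eta ->
  exists N, forall n, (N <= n)%N ->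
  Ex (@tupw _ q n)
    (fun z => (~~ (`|\sum_k f (tnth z k) - n%:R * Ex q f| <= n%:R * d))%:R) <= eta.
Proof.
move=> d0 e0; pose g z := f z - Ex q f.
have g0 : Ex q g = 0.
  have -> : Ex q g = Ex q f + Ex q (fun=> - Ex q f) by rewrite -ExD.
  by rewrite Ex_cst // subrr.
set v := Ex q (fun z => g z ^+ 2) / (d ^+ 2 * eta).
(* This bound is positive, which rules out n = 0. *)
exists (Num.bound `|v|) => -[//|n] nN.
rewrite (Ex_eq _ (G := fun z : n.+1.-tuple Z => (~~ (`|\sum_k g (tnth z k)| <= n.+1%:R * d))%:R)).
  apply: le_trans (chebyshev _ g0 d0) _.
  rewrite ler_pdivrMr ?mulr_gt0 ?exprn_gt0 ?ltr0n //.
  rewrite mulrCA -ler_pdivrMr ?mulr_gt0 ?exprn_gt0 //.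
  rewrite (mulrC eta) -/v; apply: le_trans (ler_norm _) _.
  apply: le_trans (ltW (archi_boundP (normr_ge0 _))) _.
  by rewrite ler_nat.
move=> z; rewrite sumrB sumr_const card_ord -[Ex q f *+ _]mulr_natl //.
Qed.

End LargeNumbers.

(** * Tensor powers and conditionally typical projectors *)

Section Typical.
Variable R : realType.
Local Notation C := R[i].
Local Notation op := (op R).

Definition tens (B : finType) n (F : 'I_n -> op B) : op (n.-tuple B) :=
  fun s t => \prod_k F k (tnth s k) (tnth t k).

Lemma spec_tens (B : finType) n (F W : 'I_n -> op B) (f : 'I_n -> B -> R) :
  (forall k, spec (F k) (W k) (f k)) ->
  spec (tens F) (tens W) (fun j => \prod_k f k (tnth j k)).
Proof.
move=> sF; split=> [s t|i j]; rewrite /tens.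
  under eq_bigr => k _ do rewrite (sF k).1.
  rewrite -(sum_tuple_prod (fun k b => W k (tnth s k) b * (f k b)%:C%C * (W k (tnth t k) b)^*)).
  apply: eq_bigr => u _.
  by rewrite !big_split /= !rmorph_prod.
under eq_bigr => u _ do rewrite rmorph_prod -big_split /=.
rewrite (sum_tuple_prod (fun k b => (W k b (tnth i k))^* * W k b (tnth j k))).
under eq_bigr => k _ do rewrite (sF k).2.
have [->|] := eqVneq i j; first by apply: big1 => k _; rewrite eqxx.
rewrite eqEtuple negb_forall => /existsP[k ijk].
by rewrite (bigD1 k) //= (negbTE ijk) mul0r.
Qed.

Lemma powR_log2 (x : R) : 0 < x -> 2 `^ (log2 x) = x.
Proof.
move=> x0; rewrite /powR (negbTE (lt0r_neq0 _)) // /log2 divfK ?lnK ?posrE //.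
by rewrite gt_eqF // ln_gt0 // ltr1n.
Qed.

Lemma powR2D (x y : R) : 2 `^ (x + y) = 2 `^ x * 2 `^ y.
Proof. by apply: powRD; apply/implyP => _; rewrite pnatr_eq0. Qed.

Lemma powR_sum_log2 n (a : 'I_n -> R) : (forall k, 0 < a k) ->
  2 `^ (\sum_k log2 (a k)) = \prod_k a k.
Proof.
move=> a0; rewrite (big_morph _ powR2D (powRr0 2)).
by apply: eq_bigr => k _; rewrite powR_log2.
Qed.

Variables (Y B : finType) (p : Y -> R) (F : Y -> op B).
Hypothesis dp : isdist p.
Hypothesis dF : forall y, density (F y).

(** P y projects onto the product eigenvectors of sigma y with eigenvalue within a factor 2^(n d) of
    2^(-n H). Here H is averaged over [p], so the error is small only on average over y, while the
    operator bounds hold for every y. *)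
Theorem typical_projectors (d eta : R) : 0 < d -> 0 < eta ->
  let H := Ex p (fun y => vnH (F y)) in
  exists N, forall n, (N <= n)%N ->
  exists P : n.-tuple Y -> 'M[C]_#|{: n.-tuple B}|,
  let sigma y := opmx (tens (fun k => F (tnth y k))) in
  [/\ forall y, proj (P y),
      forall y, leo (P y *m sigma y *m P y) (sigma y),
      forall y, leo (P y *m sigma y *m P y) ((2 `^ (- (n%:R * (H - d))))%:C%C *: 1%:M),
      forall y, leo (P y) ((2 `^ (n%:R * (H + d)))%:C%C *: sigma y) &
      Ex (@tupw _ _ p n) (fun y => ev (1%:M - P y) (sigma y)) <= eta].
Proof.
move=> d0 e0 H.
have [W WP] := boolp.choice (fun y => density_spec (dF y)).
have [f fP] := boolp.choice WP.
have sF y := (fP y).1; have df y := (fP y).2.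
(* Joint law of a letter and an eigenvector index; under its n-th power the logarithms of the
   eigenvalues are i.i.d. with mean -H. *)
pose q (z : Y * B) := p z.1 * f z.1 z.2.
have dq : isdist q.
  split=> [z|]; first by apply: mulr_ge0; [apply: dp.1|apply: (df _).1].
  rewrite -(pair_bigA _ (fun y b => p y * f y b)) /= -[RHS]dp.2.
  by apply: eq_bigr => y _; rewrite -mulr_sumr (df y).2 mulr1.
pose g (z : Y * B) := - log2 (f z.1 z.2).
have gH : Ex q g = H.
  rewrite /Ex -(pair_bigA _ (fun y b => p y * f y b * - log2 (f y b))) /=.
  apply: eq_bigr => y _; rewrite (vnH_spec (sF y)) -sumrN mulr_sumr.
  by apply: eq_bigr => b _; rewrite -mulrA mulrN.
have [N HN] := weak_law dq g d0 e0; exists N => n /HN {HN}; rewrite gH => HN.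
pose dev (y : n.-tuple Y) (j : n.-tuple B) :=
  `|\sum_k g (tnth y k, tnth j k) - n%:R * H| <= n%:R * d.
(* Positivity is demanded separately because [log2] takes a junk value at 0, and [lam] is a power of
   2 only for positive factors. *)
pose good y j := [forall k, 0 < f (tnth y k) (tnth j k)] && dev y j.
pose lam (y : n.-tuple Y) (j : n.-tuple B) := \prod_k f (tnth y k) (tnth j k).
pose V (y : n.-tuple Y) : 'M[C]_#|{: n.-tuple B}| := opmx (tens (fun k => W (tnth y k))).
have sT y := spec_tens (fun k => sF (tnth y k)).
have eS y := spec_opmx (sT _ y).
have VV y : (V y)^t* *m V y = 1%:M by apply: spec_unitary (sT _ y).
have VV' y := mulmx1C (VV y).
have lam0 y j : 0 <= lam y j by apply: prodr_ge0 => k _; apply: (df _).1.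
have lamE y j : [forall k, 0 < f (tnth y k) (tnth j k)] ->
    lam y j = 2 `^ (- \sum_k g (tnth y k, tnth j k)).
  by move=> /forallP h; rewrite /lam -powR_sum_log2 // -sumrN; under [in RHS]eq_bigr do rewrite opprK.
have two1 : 1 <= 2 :> R by rewrite ler1n.
exists (fun y => fcm (V y) (fun i => (good y (enum_val i))%:R)) => sigma.
have eSigma y : sigma y = fcm (V y) (fun i => lam y (enum_val i)) by apply: eS.
have ePSP y : fcm (V y) (fun i => (good y (enum_val i))%:R) *m sigma y *m
    fcm (V y) (fun i => (good y (enum_val i))%:R) =
    fcm (V y) (fun i => (good y (enum_val i))%:R * lam y (enum_val i)).
  rewrite eSigma !fcmM //; congr fcm; apply/boolp.funext => i.
  by case: (good _ _); rewrite ?(mul1r, mulr1, mul0r, mulr0).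
split=> [y|y|y|y|].
- split; first exact: fcm_adj.
  by rewrite fcmM //; congr fcm; apply/boolp.funext => i; rewrite -natrM mulnb andbb.
- rewrite ePSP eSigma; apply: fcm_le => i.
  by case: (good _ _); rewrite ?mul1r ?mul0r.
- rewrite ePSP -(fcm_cst _ (VV' y)); apply: fcm_le => i.
  case gd: (good _ _); last by rewrite mul0r powR_ge0.
  move: gd => /andP[/lamE -> /ler_normlP[h1 h2]]; rewrite mul1r.
  by apply: ler_powR => //; rewrite mulrBr; lra.
- rewrite eSigma -fcmZ; apply: fcm_le => i.
  case gd: (good _ _); last by rewrite mulr_ge0 ?powR_ge0.
  move: gd => /andP[/lamE -> /ler_normlP[h1 h2]]; rewrite -powR2D.
  rewrite -[X in X <= _](powRr0 2).
  by apply: ler_powR => //; rewrite mulrDr; lra.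
apply: le_trans HN; rewrite /Ex sum_ztuple; apply: ler_sum => y _.
have -> : ev (1%:M - fcm (V y) (fun i => (good y (enum_val i))%:R)) (sigma y) =
    \sum_j (~~ good y j)%:R * lam y j.
  rewrite -(scale1r (1%:M : 'M[C]_#|{: n.-tuple B}|)) -(fcm_cst 1 (VV' y)) -fcmN -fcmD.
  rewrite eSigma /ev fcmM // fcm_trace //= -[RHS]sum_enum_val; apply: eq_bigr => i _.
  by case: (good _ _); rewrite ?subrr ?subr0.
rewrite mulr_sumr; apply: ler_sum => j _.
have -> : tupw q (ztuple y j) = tupw p y * lam y j.
  by rewrite -big_split; apply: eq_bigr => k _; rewrite tnth_mktuple.
rewrite mulrCA mulrC; under eq_bigr => k _ do rewrite tnth_mktuple.
case gd: (good _ _); first by rewrite mulr0 mulr_ge0 // mulr_ge0 //; apply: (tupw_dist _ dp).1.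
(* A bad index either deviates, or has a zero eigenvalue factor and carries no mass. *)
move: gd; rewrite /good -/(dev y j) => /negbT/nandP[|->//].
move=> /forallPn[k]; rewrite -leNgt => fk.
have fk0 : f (tnth y k) (tnth j k) = 0 by apply/eqP; rewrite eq_le fk (df _).1.
by rewrite /lam (bigD1 k) //= fk0 !(mul0r, mulr0).
Qed.

End Typical.

(** * Averaged states and rates *)

Section Averages.
Variable R : realType.
Local Notation C := R[i].
Local Notation op := (op R).

Definition avgop (X T : finType) (p : X -> R) (F : X -> op T) : op T :=
  fun s t => \sum_x (p x)%:C%C * F x s t.

Lemma density_avgop (X T : finType) (p : X -> R) (F : X -> op T) :
  isdist p -> (forall x, density (F x)) -> density (avgop p F).
Proof.
move=> [p0 p1] dF; split; first split=> [s t|v].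
- rewrite /avgop rmorph_sum; apply: eq_bigr => x _.
  by rewrite rmorphM /= conj_RC -((dF x).1.1 s t).
- have -> : \sum_s \sum_t (v s)^* * avgop p F s t * v t =
      \sum_x (p x)%:C%C * \sum_s \sum_t (v s)^* * F x s t * v t.
    under [RHS]eq_bigr => x _ do rewrite mulr_sumr.
    rewrite [RHS]exchange_big; apply: eq_bigr => s _ /=.
    under [RHS]eq_bigr => x _ do rewrite mulr_sumr.
    rewrite [RHS]exchange_big; apply: eq_bigr => t _ /=.
    rewrite /avgop mulr_sumr mulr_suml; apply: eq_bigr => x _.
    by rewrite !mulrA (mulrC (v s)^*).
  apply: sumr_ge0 => x _; apply: mulr_ge0; first by rewrite ler0c.
  exact: (dF x).1.2.
- rewrite /trace /avgop exchange_big /=.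
  transitivity (\sum_x (p x)%:C%C : C); last by rewrite -rmorph_sum p1.
  apply: eq_bigr => x _; rewrite -mulr_sumr.
  by have := (dF x).2; rewrite /trace => ->; rewrite mulr1.
Qed.

(** Averaging over i.i.d. letters acts factor by factor, so averaged codeword states are again
    product states with typical projectors. *)
Lemma tens_avgop (X B : finType) (p : X -> R) n (G : 'I_n -> X -> op B) :
  \sum_(b : n.-tuple X) (tupw p b)%:C%C *: opmx (tens (fun k => G k (tnth b k))) =
  opmx (tens (fun k => avgop p (G k))).
Proof.
apply/matrixP => i j; rewrite summxE mxE /tens /avgop.
rewrite -(sum_tuple_prod (fun k x => (p x)%:C%C *
   G k x (tnth (enum_val i) k) (tnth (enum_val j) k))).
by apply: eq_bigr => b _; rewrite !mxE big_split /= rmorph_prod.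
Qed.

Lemma eq_tens (B : finType) n (F G : 'I_n -> op B) : F =1 G ->
  opmx (tens F) = opmx (tens G).
Proof. by move=> /boolp.funext ->. Qed.

Lemma trace_opmx (T : finType) (A : op T) : \tr (opmx A) = trace A.
Proof. by rewrite /trace -sum_enum_val; apply: eq_bigr => i _; rewrite mxE. Qed.

Lemma tens_state (B : finType) n (F : 'I_n -> op B) : (forall k, density (F k)) ->
  pos (opmx (tens F)) /\ ev 1%:M (opmx (tens F)) = 1.
Proof.
move=> dF; have [W WP] := boolp.choice (fun k => density_spec (dF k)).
have [f fP] := boolp.choice WP.
have sT := spec_tens (fun k => (fP k).1); split.
  rewrite (spec_opmx sT); apply: fcm_pos => i; apply: prodr_ge0 => k _.
  exact: (fP k).2.1.
rewrite /ev mul1mx trace_opmx (spec_trace sT) /= sum_tuple_prod.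
by apply: big1 => k _; apply: (fP k).2.2.
Qed.

Definition mxop (T : finType) (A : 'M[C]_#|T|) : op T :=
  fun s t => A (enum_rank s) (enum_rank t).

Lemma mxop_psd (T : finType) (A : 'M[C]_#|T|) : pos A -> psd (mxop A).
Proof.
move=> pA; split=> [s t|v].
  by rewrite /mxop -{1}(pos_herm pA) !mxE.
case: pA => K ->; pose w : 'cV[C]_#|T| := \col_i v (enum_val i).
have -> : \sum_s \sum_t (v s)^* * mxop (K *m K^t*) s t * v t =
    ((K^t* *m w)^t* *m (K^t* *m w)) 0 0.
  rewrite adjM trmxCK -mulmxA (mulmxA K) mxE -[LHS]sum_enum_val.
  apply: eq_bigr => i _; rewrite [(_ *m w) i 0]mxE mulr_sumr -[LHS]sum_enum_val.
  apply: eq_bigr => j _; rewrite ![w _ _]mxE ![(w^t*) _ _]mxE /mxop !enum_valK.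
  by rewrite !mxE mulrA.
rewrite mxE; apply: sumr_ge0 => i _.
by rewrite mxE mxE mulrC mul_conjC_ge0.
Qed.

Lemma mxop_error (T : finType) (A : 'M[C]_#|T|) (B : op T) :
  complex.Re (trace (opmul (opsub (@idop R T) (mxop A)) B)) = ev (1%:M - A) (opmx B).
Proof.
rewrite /ev -trace_opmx; congr (complex.Re (\tr _)); apply/matrixP => i j.
rewrite !mxE /opmul -sum_enum_val; apply: eq_bigr => k _.
by rewrite !mxE /opsub /idop /mxop !enum_valK (inj_eq enum_val_inj).
Qed.

End Averages.

(** * Conditional entropies of theta as averages *)

Section Entropies.
Variables (R : realType) (X1 X2 : finType) (d : nat).
Variables (p1 : X1 -> R) (p2 : X2 -> R) (rho : X1 -> X2 -> op R 'I_d).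
Hypotheses (d1 : isdist p1) (d2 : isdist p2).
Hypothesis drho : forall x1 x2, density (rho x1 x2).

Definition prodw (x : X1 * X2) : R := p1 x.1 * p2 x.2.
Definition rho1 x1 := avgop p2 (rho x1).
Definition rho2 x2 := avgop p1 (rho^~ x2).
Definition rho0 := avgop p2 rho2.

Lemma prodw_dist : isdist prodw.
Proof.
split=> [x|]; first by apply: mulr_ge0; [apply: d1.1|apply: d2.1].
rewrite -(pair_bigA _ (fun a b => p1 a * p2 b)) /= -[RHS]d1.2.
by apply: eq_bigr => a _; rewrite -mulr_sumr d2.2 mulr1.
Qed.

Lemma theta_X1X2E s t : theta_X1X2 p1 p2 rho s t = dop prodw s t.
Proof.
rewrite /theta_X1X2 /ptrR /theta /dop /=.
by rewrite -mulr_sumr; have := (drho s.1 s.2).2; rewrite /trace => ->; rewrite mulr1.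
Qed.

(** The Shannon term of [vnH_cqop] cancels against the entropy of the classical marginal; the same
    happens in [H_B_X2E] and [H_B_X1E]. *)
Lemma H_B_X1X2E :
  H_B_X1X2 p1 p2 rho = Ex prodw (fun x => vnH (rho x.1 x.2)).
Proof.
rewrite /H_B_X1X2 (eq_vnH theta_X1X2E) vnH_dop.
rewrite (eq_vnH (B := cqop prodw (fun x => rho x.1 x.2))) //.
by rewrite (vnH_cqop prodw_dist (fun x => drho x.1 x.2)) addrAC subrr add0r.
Qed.

Lemma H_B_X2E : H_B_X2 p1 p2 rho = Ex p2 (fun x => vnH (rho2 x)).
Proof.
have e1 : vnH (theta_X2B p1 p2 rho) = shannon p2 + Ex p2 (fun x => vnH (rho2 x)).
  rewrite -(vnH_cqop d2 (fun x => density_avgop d1 (fun a => drho a x))).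
  apply: eq_vnH => -[x b] [y c]; rewrite /theta_X2B /ptrL /reidx /theta /cqop /=.
  rewrite /rho2 /avgop mulr_sumr; apply: eq_bigr => a _.
  by rewrite xpair_eqE eqxx /= rmorphM /=; ring.
have e2 : vnH (theta_X2 p1 p2 rho) = shannon p2.
  rewrite -vnH_dop; apply: eq_vnH => s t; rewrite /theta_X2 /ptrL.
  under eq_bigr => a _ do rewrite theta_X1X2E /dop xpair_eqE eqxx /= rmorphM /= mulrCA.
  by rewrite -mulr_suml -rmorph_sum d1.2 mul1r.
by rewrite /H_B_X2 e1 e2 addrAC subrr add0r.
Qed.

Lemma H_B_X1E : H_B_X1 p1 p2 rho = Ex p1 (fun x => vnH (rho1 x)).
Proof.
have e1 : vnH (theta_X1B p1 p2 rho) = shannon p1 + Ex p1 (fun x => vnH (rho1 x)).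
  rewrite -(vnH_cqop d1 (fun x => density_avgop d2 (drho x))).
  apply: eq_vnH => -[x b] [y c]; rewrite /theta_X1B /ptrL /reidx /theta /cqop /=.
  rewrite /rho1 /avgop mulr_sumr; apply: eq_bigr => a _.
  by rewrite xpair_eqE eqxx andbT /= rmorphM /=; ring.
have e2 : vnH (theta_X1 p1 p2 rho) = shannon p1.
  rewrite -vnH_dop; apply: eq_vnH => s t; rewrite /theta_X1 /ptrR.
  under eq_bigr => a _ do
    rewrite theta_X1X2E /dop xpair_eqE eqxx andbT /= rmorphM /= mulrA.
  by rewrite -mulr_sumr -rmorph_sum d2.2 mulr1.
by rewrite /H_B_X1 e1 e2 addrAC subrr add0r.
Qed.

Lemma H_BE : H_B p1 p2 rho = vnH rho0.
Proof.
apply: eq_vnH => s t; rewrite /theta_B /ptrL /theta /rho0 /avgop /rho2 /avgop /=.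
rewrite -(pair_bigA _ (fun a b => ((a, b) == (a, b))%:R * (p1 a * p2 b)%:C%C * rho a b s t)) /=.
rewrite exchange_big; apply: eq_bigr => b _; rewrite mulr_sumr.
by apply: eq_bigr => a _; rewrite eqxx mul1r rmorphM /=; ring.
Qed.

End Entropies.

(** * Codebook sizes, exponents and the error budget *)

Section Rates.
Variable R : realType.

Lemma msize_gt0 n (r dl : R) : (0 < msize n r dl)%N.
Proof. by rewrite absz_gt0 gt_eqF // ceil_gt0 powR_gt0. Qed.

(** Rounding up adds less than one, so the count of wrong messages stays below the unrounded
    size. *)
Lemma msize_pred n (r dl : R) : (msize n r dl).-1%:R <= 2 `^ (n%:R * (r - dl)) :> R.
Proof.
set y := 2 `^ _; have y0 : 0 < y by apply: powR_gt0.
have e : (msize n r dl)%:Z = Num.ceil y by rewrite gez0_abs // ltW // ceil_gt0.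
have := ceil_gt_int y (Num.ceil y - 1); rewrite gtrBl ltr01 => /esym.
rewrite -e -(prednK (msize_gt0 n r dl)) -natz -natr1 natz addrK => h.
exact: ltW.
Qed.

(** From 2^(n c) = exp(n c ln 2) >= 1 + n c ln 2. *)
Lemma powR_decay (c eps : R) : 0 < c -> 0 < eps ->
  exists N, forall n, (N <= n)%N -> 2 `^ (- (n%:R * c)) <= eps.
Proof.
move=> c0 e0; have l0 : 0 < ln 2 :> R by rewrite ln_gt0 // ltr1n.
exists (Num.bound (eps^-1 / (c * ln 2))) => n nN.
rewrite powRN -[leRHS]invrK lef_pV2 ?posrE ?invr_gt0 ?powR_gt0 //.
rewrite /powR pnatr_eq0 /=; apply: le_trans (expR_ge1Dx _).
have : eps^-1 / (c * ln 2) <= n%:R.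
  apply: le_trans (ltW (archi_boundP _)) _; last by rewrite ler_nat.
  by rewrite divr_ge0 ?invr_ge0 ?ltW // mulr_gt0.
rewrite ler_pdivrMr ?mulr_gt0 // mulrA => h; apply: le_trans h _.
by rewrite lerDr.
Qed.

Lemma rates_bound n (m1 m2 R1 R2 H0 H1 H2 H12 dl x : R) : 0 < dl -> 0 <= m1 -> 0 <= m2 ->
  m1 <= 2 `^ (n%:R * (R1 - dl)) -> m2 <= 2 `^ (n%:R * (R2 - dl)) ->
  R1 <= H2 - H12 -> R2 <= H1 - H12 -> R1 + R2 <= H0 - H12 ->
  let k := 2 `^ (n%:R * (H12 + dl / 4)) in
  let l H := 2 `^ (- (n%:R * (H - dl / 4))) in
  2 `^ (- (n%:R * (dl / 2))) <= x ->
  m2 * (l H1 * k) + m1 * (l H2 * k + m2 * (l H0 * k)) <= 3 * x.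
Proof.
move=> dl0 m10 m20 h1 h2 r1 r2 r12 k l hx.
have n0 : 0 <= n%:R :> R by [].
have two1 : 1 <= 2 :> R by rewrite ler1n.
(* The two typicality slacks dl / 4 use up half of the rate gap [dl], leaving the exponent -n dl /
   2. *)
have gen (m r H : R) : 0 <= m -> m <= 2 `^ (n%:R * r) -> r <= H - H12 - dl ->
    m * (l H * k) <= x.
  move=> m0 hm hr; apply: le_trans hx.
  apply: le_trans (ler_wpM2r _ hm) _; first by rewrite mulr_ge0 ?powR_ge0.
  rewrite -!powR2D; apply: ler_powR => //.
  rewrite -!mulrN -!mulrDr; apply: ler_wpM2l => //; lra.
have g2 := gen m2 (R2 - dl) H1 m20 h2; have g1 := gen m1 (R1 - dl) H2 m10 h1.
(* The sum rate is lowered by 2 dl, more than the gap required. *)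
have g12 : m1 * m2 * (l H0 * k) <= x.
  apply: (gen _ (R1 - dl + (R2 - dl))); [by apply: mulr_ge0| |by lra].
  by rewrite mulrDr powR2D ler_pM.
have := g1; have := g2; have {}g1 : R1 - dl <= H2 - H12 - dl by lra.
have {}g2 : R2 - dl <= H1 - H12 - dl by lra.
move=> /(_ g2) a2 /(_ g1) a1; rewrite mulrDr [m1 * (m2 * _)]mulrA.
by move: a1 a2 g12; lra.
Qed.

End Rates.

(** Four contributions of eps / 5 each: the terms in [eta], 8 t, 2 e, and the cross terms. *)
Lemma error_budget (R : realType) (eps : R) : 0 < eps ->
  let t := eps / 40 in let e := eps / 10 in
  let eta := eps / 5 / (10 + 96 / t) in
  [/\ 0 < t, 0 < e, 0 < eta & 10 * eta + (8 * t + 2 * e) + 32 / t * (3 * eta) +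
    8 * (3 * (eps / 120)) <= eps].
Proof.
move=> e0 t e eta; have t0 : 0 < t by rewrite divr_gt0.
have w0 : 0 < 96 / t by rewrite divr_gt0.
have eE : eta * (10 + 96 / t) = eps / 5 by rewrite divfK // gt_eqF //; lra.
split=> //; [by rewrite divr_gt0|by rewrite !divr_gt0 //; lra|].
have -> : 32 / t * (3 * eta) = 96 / t * eta by field; rewrite gt_eqF.
by move: (96 / t) eE => u eE; rewrite /t /e; nra.
Qed.

(** Exchanging the codebook expectation with the message average reduces the claim to a bound
    uniform in the message pair. *)
Lemma exp_avg_err_le (R : realType) (X1 X2 : finType) (d : nat) (p1 : X1 -> R)
    (p2 : X2 -> R) (rho : X1 -> X2 -> op R 'I_d) n M1 M2
    (L : {ffun 'I_M1 -> n.-tuple X1} -> {ffun 'I_M2 -> n.-tuple X2} ->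
       'I_M1 -> 'I_M2 -> 'M[R[i]]_#|{: n.-tuple 'I_d}|) (b : R) :
  (0 < M1)%N -> (0 < M2)%N ->
  (forall m1 m2, Ex (@cbw _ _ (@tupw _ _ p1 n) M1) (fun c1 =>
    Ex (@cbw _ _ (@tupw _ _ p2 n) M2) (fun c2 =>
       ev (1%:M - L c1 c2 m1 m2) (opmx (rho_n rho (c1 m1) (c2 m2))))) <= b) ->
  exp_avg_err p1 p2 rho (fun c1 c2 m1 m2 => mxop (L c1 c2 m1 m2)) <= b.
Proof.
move=> M10 M20 h; pose w := (M1%:R * M2%:R : R)^-1.
have -> : exp_avg_err p1 p2 rho (fun c1 c2 m1 m2 => mxop (L c1 c2 m1 m2)) =
    w * \sum_m1 \sum_m2 Ex (@cbw _ _ (@tupw _ _ p1 n) M1) (fun c1 =>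
    Ex (@cbw _ _ (@tupw _ _ p2 n) M2) (fun c2 =>
       ev (1%:M - L c1 c2 m1 m2) (opmx (rho_n rho (c1 m1) (c2 m2))))).
  under eq_bigr => m1 _ do rewrite -Ex_sum.
  rewrite -Ex_sum -ExZ; apply: eq_bigr => c1 _.
  under [in RHS]eq_bigr => m1 _ do rewrite -Ex_sum.
  rewrite -Ex_sum -ExZ /Ex mulr_sumr; apply: eq_bigr => c2 _.
  rewrite -mulrA; congr (_ * (_ * (_ * _))).
  by apply: eq_bigr => m1 _; apply: eq_bigr => m2 _; apply: mxop_error.
rewrite mulrC ler_pdivrMr; last by rewrite mulr_gt0 ?ltr0n.
apply: (@le_trans _ _ (\sum_(m1 < M1) \sum_(m2 < M2) b)).
  by apply: ler_sum => m1 _; apply: ler_sum => m2 _; apply: h.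
by rewrite !sumr_const !card_ord -[leLHS]mulr_natr -[X in X * _]mulr_natr -mulrA (mulrC M2%:R).
Qed.

(** * Achievability of the rate region by simultaneous decoding *)

Theorem theorem2 (R : realType) (X1 X2 : finType) (d : nat)
  (rho : X1 -> X2 -> op R 'I_d) (p1 : X1 -> R) (p2 : X2 -> R) (R1 R2 : R) :
  (forall x1 x2, density (rho x1 x2)) ->
  isdist p1 -> isdist p2 ->
  R1 <= I_X1_B_X2 p1 p2 rho ->
  R2 <= I_X2_B_X1 p1 p2 rho ->
  R1 + R2 <= I_X1X2_B p1 p2 rho ->
  forall eps delta : R, 0 < eps -> 0 < delta ->
  exists N : nat, forall n : nat, (N <= n)%N ->
    let M1 := msize n R1 delta in
    let M2 := msize n R2 delta in
    exists L : {ffun 'I_M1 -> n.-tuple X1} -> {ffun 'I_M2 -> n.-tuple X2} ->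
               'I_M1 -> 'I_M2 -> op R (n.-tuple 'I_d),
      (forall c1 c2, povm (fun m : ('I_M1 * 'I_M2)%type => L c1 c2 m.1 m.2)) /\
      exp_avg_err p1 p2 rho L <= eps.
Proof.
move=> drho d1 d2.
rewrite /I_X1_B_X2 /I_X2_B_X1 /I_X1X2_B (H_B_X1X2E d1 d2 drho) (H_B_X2E d1 d2 drho).
rewrite (H_B_X1E d1 d2 drho) H_BE.
set H12 := Ex (prodw p1 p2) _; set H2 := Ex p2 _; set H1 := Ex p1 _; set H0 := vnH _.
move=> r1 r2 r12 eps delta eps0 delta0.
have [t0 e0 eta0 budget] := error_budget eps0.
set t := eps / 40 in t0 eta0 budget; set e := eps / 10 in e0 budget.
set eta := eps / 5 / _ in eta0 budget.
have dl0 : 0 < delta / 4 by rewrite divr_gt0.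
have drho1 x : density (rho1 p2 rho x) by apply: density_avgop.
have drho2 x : density (rho2 p1 rho x) by apply: density_avgop => // y; apply: drho.
have drho0 : density (rho0 p1 p2 rho) by apply: density_avgop.
(* The unconditional projector for [rho0] is the conditional one over a one-letter alphabet. *)
have du : isdist (fun _ : unit => 1 : R).
  by split=> [_|]; rewrite ?big_const ?card_unit /= ?addr0.
have [N0 HN0] := typical_projectors du (fun=> drho0) dl0 eta0.
have [N1 HN1] := typical_projectors d1 drho1 dl0 eta0.
have [N2 HN2] := typical_projectors d2 drho2 dl0 eta0.
have [N12 HN12] := typical_projectors (prodw_dist d1 d2)
  (fun x => drho x.1 x.2) dl0 eta0.
have c0 : 0 < delta / 2 by rewrite divr_gt0.
have x0 : 0 < eps / 120 by rewrite divr_gt0.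
have [Nd HNd] := powR_decay c0 x0.
exists (maxn (maxn N0 N1) (maxn N2 (maxn N12 Nd))) => n.
rewrite !geq_max => /andP[/andP[/HN0 {HN0} HN0 /HN1 {HN1} HN1]].
move=> /and3P[/HN2 {HN2} HN2 /HN12 {HN12} HN12 /HNd {HNd} HNd].
set M1 := msize n R1 delta; set M2 := msize n R2 delta.
have {HN0} [P0 [pP0 _ P0le _ P0err]] := HN0.
have {HN1} [P1 [pP1 _ P1le _ P1err]] := HN1.
have {HN2} [P2 [pP2 P2le' P2le _ P2err]] := HN2.
have {HN12} [P12 [pP12 _ _ P12le P12err]] := HN12.
pose q1 := @tupw R X1 p1 n; pose q2 := @tupw R X2 p2 n.
have dq1 : isdist q1 by apply: tupw_dist.
have dq2 : isdist q2 by apply: tupw_dist.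
pose sigma (a : n.-tuple X1) (b : n.-tuple X2) := opmx (rho_n rho a b).
have st (a : n.-tuple X1) (b : n.-tuple X2) := tens_state (fun k => drho (tnth a k) (tnth b k)).
have spos a b : pos (sigma a b) by case: (st a b).
have str a b : ev 1%:M (sigma a b) = 1 by case: (st a b).
have E1 a : avg1 q2 sigma a = opmx (tens (fun k => rho1 p2 rho (tnth a k))).
  exact: (tens_avgop p2 (fun k => rho (tnth a k))).
have E2 b : avg2 q1 sigma b = opmx (tens (fun k => rho2 p1 rho (tnth b k))).
  exact: (tens_avgop p1 (fun k x => rho x (tnth b k))).
have E0 : avg12 q1 q2 sigma = opmx (tens (fun k : 'I_n => rho0 p1 p2 rho)).
  rewrite /avg12; under eq_bigr => b _ do rewrite E2.
  exact: (tens_avgop p2 (fun k => rho2 p1 rho)).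
have E12 a b : opmx (tens (fun k => rho (tnth (ztuple a b) k).1 (tnth (ztuple a b) k).2)) =
    sigma a b.
  apply: (@eq_tens _ _ n _ (fun k => rho (tnth a k) (tnth b k))) => k.
  by rewrite tnth_mktuple.
pose u0 : n.-tuple unit := [tuple tt | _ < n].
pose l H := 2 `^ (- (n%:R * (H - delta / 4))).
pose k := 2 `^ (n%:R * (H12 + delta / 4)).
have h12 a b : leo (P12 (ztuple a b)) (k%:C%C *: sigma a b).
  by rewrite -E12; apply: P12le.
have h2 b : leo (P2 b *m avg2 q1 sigma b *m P2 b) ((l H2)%:C%C *: 1%:M).
  by rewrite E2; apply: P2le.
have h2' b : leo (P2 b *m avg2 q1 sigma b *m P2 b) (avg2 q1 sigma b).
  by rewrite E2; apply: P2le'.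
have h1 a : leo (P1 a *m avg1 q2 sigma a *m P1 a) ((l H1)%:C%C *: 1%:M).
  by rewrite E1; apply: P1le.
have h0 : leo (P0 u0 *m avg12 q1 q2 sigma *m P0 u0) ((l H0)%:C%C *: 1%:M).
  by have := P0le u0; rewrite (Ex_cst du) E0.
have e0' : ev (1%:M - P0 u0) (avg12 q1 q2 sigma) <= eta.
  (* [u0] is the only tuple over [unit], so the averaged error is this single term. *)
  rewrite E0; move: P0err; rewrite /Ex (bigD1 u0) //= big1 ?addr0.
    by rewrite /tupw big1 // mul1r.
  by move=> u; case/eqP; apply: eq_from_tnth => i; case: (tnth u i); case: (tnth u0 i).
have e1 : Ex q1 (fun a => ev (1%:M - P1 a) (avg1 q2 sigma a)) <= eta.
  by under Ex_eq => a do rewrite E1.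
have e2 : Ex q2 (fun b => ev (1%:M - P2 b) (avg2 q1 sigma b)) <= eta.
  by under Ex_eq => b do rewrite E2.
have e12 : Ex q1 (fun a => Ex q2 (fun b =>
    ev (1%:M - P12 (ztuple a b)) (sigma a b))) <= eta.
  apply: le_trans P12err; rewrite le_eqVlt; apply/orP; left; apply/eqP.
  rewrite /Ex sum_ztuple.
  apply: eq_bigr => a _; rewrite mulr_sumr; apply: eq_bigr => b _.
  rewrite mulrA E12; congr (_ * _); rewrite -big_split; apply: eq_bigr => i _.
  by rewrite tnth_mktuple.
have [L [L0 L1 HL]] := one_shot dq1 dq2 spos str (pP0 u0) pP1 pP2
  (fun a b => pP12 (ztuple a b)) (powR_ge0 _ _) (powR_ge0 _ _) (powR_ge0 _ _)
  (powR_ge0 _ _) h12 h2 h2' h1 h0 (msize_gt0 n R1 delta) (msize_gt0 n R2 delta)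
  t0 e0 e0' e1 e2 e12.
exists (fun c1 c2 m1 m2 => mxop (L c1 c2 (m1, m2))); split.
  move=> c1 c2; split=> [m|s t']; first exact: mxop_psd.
  have := congr1 (fun A : 'M_#|{: n.-tuple 'I_d}| => A (enum_rank s) (enum_rank t'))
    (L1 c1 c2).
  rewrite summxE mxE (inj_eq enum_rank_inj) /idop => <-.
  by apply: eq_bigr => -[m1 m2] _.
apply: le_trans budget; apply: exp_avg_err_le; [exact: msize_gt0|exact: msize_gt0|].
move=> m1 m2; apply: le_trans (HL (m1, m2)) _; rewrite lerD2l ler_pM2l //.
by apply: rates_bound (msize_pred _ _ _) (msize_pred _ _ _) r1 r2 r12 HNd.
Qed.
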